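(* Let $\mathfrak g$ be a simple finite-dimensional Lie algebra over an algebraically closed field $\mathbb F$ of characteristic $0$, and let $e\in\mathfrak g$ be a nonzero nilpotent element of depth $d$. Then $e$ is of nilpotent type if and only if $d$ is odd.
   Context: For a nonzero nilpotent $e\in\mathfrak g$, fix an $\mathfrak{sl}_2$-triple $\mathfrak s=\{e,h,f\}$ with $[e,f]=h$, $[h,e]=2e$, $[h,f]=-2f$ (it exists by Jacobson–Morozov). Let $\mathfrak g_j$ be the eigenspace of $\mathrm{ad}\,h$ with eigenvalue $j\in\mathbb Z$, so $\mathfrak g=\bigoplus_{j=-d}^{d}\mathfrak g_j$ with $\mathfrak g_{\pm d}\neq 0$; the positive integer $d$ is the depth of $e$. A cyclic element associated with $e$ is an element $e+F$ with $0\neq F\in\mathfrak g_{-d}$. The element $e$ is of nilpotent type if every cyclic element associated with $e$ is nilpotent. *)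

(* Defs.v *)
From HB Require Import structures.
From mathcomp Require Import all_boot all_order all_algebra.
Set Implicit Arguments. Unset Strict Implicit. Unset Printing Implicit Defensive.
Import Order.TTheory GRing.Theory Num.Theory.
Local Open Scope ring_scope.

Section Lie.
Variables (F : fieldType) (L : vectType F).

Definition lie_bracket (br : L -> L -> L) : Prop :=
  [/\ (forall (a : F) (x y z : L), br (a *: x + y) z = a *: br x z + br y z),
      (forall (a : F) (x y z : L), br z (a *: x + y) = a *: br z x + br z y),
      (forall x : L, br x x = 0)
    & (forall x y z : L, br x (br y z) + br y (br z x) + br z (br x y) = 0)].

Definition lie_ideal (br : L -> L -> L) (I : {vspace L}) : Prop :=
  forall x y : L, y \in I -> br x y \in I.

Definition simple_lie (br : L -> L -> L) : Prop :=
  (exists x y : L, br x y != 0) /\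
  (forall I : {vspace L}, lie_ideal br I -> I = 0%VS \/ I = fullv).

Definition ad_nilpotent (br : L -> L -> L) (x : L) : Prop :=
  exists n : nat, forall y : L, iter n (br x) y = 0.

Definition sl2_triple (br : L -> L -> L) (e h f : L) : Prop :=
  [/\ br e f = h, br h e = 2%:R *: e & br h f = - (2%:R *: f)].

Definition in_grade (br : L -> L -> L) (h : L) (j : int) (x : L) : Prop :=
  br h x = j%:~R *: x.

Definition is_depth (br : L -> L -> L) (h : L) (d : nat) : Prop :=
  (exists x : L, x != 0 /\ in_grade br h d%:Z x) /\
  (forall (j : int) (x : L), (d%:Z < j)%R -> in_grade br h j x -> x = 0).

(* e is of nilpotent type (w.r.t. the triple with semisimple element h and depth d):
   every cyclic element e + F with 0 <> F in g_{-d} is nilpotent. *)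
Definition nilpotent_type (br : L -> L -> L) (e h : L) (d : nat) : Prop :=
  forall Fm : L, Fm != 0 -> in_grade br h (- d%:Z) Fm -> ad_nilpotent br (e + Fm).

End Lie.

(* Main.v *)
Require Import Defs.
From HB Require Import structures.
From mathcomp Require Import all_boot all_order all_algebra all_field.
From mathcomp Require Import cyclic ring zify.
Set Implicit Arguments. Unset Strict Implicit. Unset Printing Implicit Defensive.
Import Order.TTheory GRing.Theory Num.Theory.
Import VectorInternalTheory.
Local Open Scope ring_scope.

(**
Write g_j for the eigenspaces of ad h and m = d + 2, so that e + F is homogeneous
of degree 2 for the grading of g modulo m.

If d is even, the form (x, y) |-> kappa ((ad e)^d x) y on g_{-d} is symmetric and
nondegenerate (kappa is the Killing form, nonzero because kappa(h, h) is a sum of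
squares of integers, hence nondegenerate by simplicity). For F with
kappa ((ad e)^d F) F <> 0, correcting (ad e)^d F by an element of g_{-2} yields z
commuting with e + F such that kappa (e + F) z <> 0, so e + F is not nilpotent.

If d is odd, suppose T = ad (e + F) has a nonzero eigenvalue and let w be a primitive
m-th root of unity; m being odd, so is w^2, and both are conjugate over the
rationals. Hence there is a nonzero map phi, additive on the set of eigenvalues (made
stable under w^2), with phi (w^2 a) = w phi(a). Multiplication by phi(a) on the
generalized a-eigenspace of T is a derivation of degree 1 modulo m, therefore inner
and given by an element of g_1: it is nilpotent, yet it has a nonzero eigenvalue.
*)

(** * Polynomials in an endomorphism, applied to vectors *)

Section PolyAction.
Variables (F : fieldType) (L : vectType F) (T : 'End(L)).
Implicit Types (p q : {poly F}) (v w : L) (c : F).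

Definition pact p v : L := \sum_(i < size p) p`_i *: iter i T v.

Lemma pactE p v n : (size p <= n)%N -> pact p v = \sum_(i < n) p`_i *: iter i T v.
Proof.
move=> le_pn; rewrite /pact (big_ord_widen n (fun i => p`_i *: iter i T v)) //.
rewrite big_mkcond; apply: eq_bigr => i _.
by case: ltnP => // le_pi; rewrite nth_default ?scale0r.
Qed.

Fact iter_is_linear i : linear (iter i T).
Proof. by elim: i => // i IHi a u v; rewrite !iterS IHi linearP. Qed.

HB.instance Definition _ i := GRing.isLinear.Build F L L _ (iter i T) (iter_is_linear i).

Fact pact_is_linear p : linear (pact p).
Proof.
move=> a u v; rewrite /pact scaler_sumr -big_split /=; apply: eq_bigr => i _.
by rewrite iter_is_linear scalerDr !scalerA mulrC.
Qed.
HB.instance Definition _ p := GRing.isLinear.Build F L L _ (pact p) (pact_is_linear p).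

Lemma pactD p q v : pact (p + q) v = pact p v + pact q v.
Proof.
pose n := maxn (size p) (size q).
rewrite (@pactE _ _ n) ?size_polyD // (@pactE p _ n) ?leq_maxl //.
rewrite (@pactE q _ n) ?leq_maxr // -big_split /=.
by apply: eq_bigr => i _; rewrite coefD scalerDl.
Qed.

Lemma pactZ c p v : pact (c *: p) v = c *: pact p v.
Proof.
rewrite (@pactE _ _ (size p)) ?size_scale_leq // /pact scaler_sumr.
by apply: eq_bigr => i _; rewrite coefZ scalerA.
Qed.

Lemma pactC c v : pact c%:P v = c *: v.
Proof. by rewrite (@pactE _ _ 1) ?size_polyC_leq1 // big_ord1 coefC. Qed.

Lemma pact0 v : pact 0 v = 0.
Proof. by rewrite -polyC0 pactC scale0r. Qed.

Lemma pactMX p v : pact (p * 'X) v = T (pact p v).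
Proof.
rewrite (@pactE _ _ (size p).+1); last first.
  by apply: leq_trans (size_polyMleq _ _) _; rewrite size_polyX addn2.
rewrite big_ord_recl coefMX scale0r add0r /pact linear_sum /=.
by apply: eq_bigr => i _; rewrite coefMX /= linearZ.
Qed.

Lemma pactM p q v : pact (p * q) v = pact p (pact q v).
Proof.
elim/poly_ind: p => [|p c IHp]; first by rewrite mul0r !pact0.
rewrite mulrDl !pactD -mulrA (mulrC 'X) mulrA !pactMX IHp.
by rewrite mul_polyC pactZ pactC.
Qed.

Lemma pactX v : pact 'X v = T v.
Proof. by rewrite -[_ v]/(pact 'X v) -(mul1r 'X) pactMX -polyC1 pactC scale1r. Qed.

Lemma pactXsubC c v : pact ('X - c%:P) v = T v - c *: v.
Proof. by rewrite pactD pactX -polyCN pactC scaleNr. Qed.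

Lemma pact_dvdp p q v : p %| q -> pact p v = 0 -> pact q v = 0.
Proof. by move/dvdpP => [r ->] pv0; rewrite pactM pv0 linear0. Qed.

Lemma pact_coprime p q v : coprimep p q -> pact p v = 0 -> pact q v = 0 -> v = 0.
Proof.
move=> /Bezout_eq1_coprimepP [[a b] /= ab1] pv0 qv0.
by rewrite -[v]scale1r -pactC polyC1 -ab1 pactD !pactM pv0 qv0 !linear0 addr0.
Qed.

(** The first [n + 1] powers of [T] lie in a space of dimension [n], so they satisfy a linear
    relation, found as a nonzero row in the left kernel of the matrix of their coordinates. *)
Lemma annihilating_poly : exists2 p : {poly F}, p != 0 & forall v, pact p v = 0.
Proof.
pose P i := iter i (fun g : 'End(L) => (T \o g)%VF) \1%VF.
have PE i v : P i v = iter i T v.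
  by elim: i => [|i IHi] /=; rewrite ?id_lfunE // comp_lfunE IHi.
pose n := dim 'End(L).
pose A : 'M[F]_(n.+1, n) := \matrix_(i < n.+1) v2r (P i).
have nzK : kermx A != 0.
  by rewrite kermx_eq0 /row_free neq_ltn ltnS rank_leq_col.
pose k := nz_row (kermx A).
have nzk : k != 0 by rewrite nz_row_eq0.
have sk : \sum_(i < n.+1) k 0 i *: P i = 0.
  apply: (can_inj (@v2rK _ _)); rewrite linear0.
  have /sub_kermxP := nz_row_sub (kermx A); rewrite mulmx_sum_row => <-.
  by rewrite linear_sum; apply: eq_bigr => i _; rewrite linearZ /= rowK.
exists (\poly_(i < n.+1) k 0 (inord i)).
  apply: contra nzk => /eqP /polyP k0; apply/eqP/rowP => i.
  by have := k0 i; rewrite coef_poly ltn_ord inord_val coef0 mxE.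
move=> v; rewrite (pactE _ (size_poly _ _)).
transitivity ((\sum_(i < n.+1) k 0 i *: P i) v); last by rewrite sk zero_lfunE.
rewrite sum_lfunE; apply: eq_bigr => j _.
by rewrite coef_poly ltn_ord inord_val scale_lfunE PE.
Qed.

Lemma pact_root_eq0 c k v : (forall u, T u = c *: u -> u = 0) ->
  pact (('X - c%:P) ^+ k) v = 0 -> v = 0.
Proof.
move=> inj; elim: k v => [|k IHk] v; first by rewrite expr0 -polyC1 pactC scale1r.
rewrite exprS pactM pactXsubC => /eqP; rewrite subr_eq0 => /eqP /inj.
exact: IHk.
Qed.

End PolyAction.

Section PolyActionShift.
Variables (F : fieldType) (L : vectType F) (T : 'End(L)).

Lemma pact_eigen p c v : T v = c *: v -> pact T p v = p.[c] *: v.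
Proof.
move=> Tv; elim/poly_ind: p => [|p b IHp]; first by rewrite pact0 horner0 scale0r.
by rewrite pactD pactMX IHp linearZ /= Tv pactC hornerMXaddC scalerA scalerDl.
Qed.

(** The hypothesis reads [(T - c) g = g T]. Consequently [g] maps the generalized [a]-eigenspace of
    [T] into the one for [a + c]. *)
Lemma pact_shift (g : {linear L -> L}) c p v :
  (forall u, T (g u) = g (T u) + c *: g u) ->
  g (pact T p v) = pact T (p \Po ('X - c%:P)) (g v).
Proof.
move=> Tg; elim/poly_ind: p => [|p b IHp]; first by rewrite comp_poly0 !pact0 linear0.
rewrite comp_poly_MXaddC (mulrC (p \Po _)) !pactD pactMX !pactC pactM pactXsubC.
by rewrite linearD linearZ /= -IHp Tg addrK.
Qed.

Lemma iter_shift (g : 'End(L)) c k v :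
  (forall u, T (g u) = g (T u) + c *: g u) ->
  T (iter k g v) = iter k g (T v) + (c *+ k) *: iter k g v.
Proof.
move=> Tg; elim: k => [|k IHk]; first by rewrite mulr0n scale0r addr0.
by rewrite !iterS Tg IHk linearD linearZ /= mulrSr scalerDl addrA.
Qed.

End PolyActionShift.

(** * Primary decomposition and interpolation *)

Lemma coprimep_XsubC_exp (F : fieldType) (a b : F) k l :
  a != b -> coprimep (('X - a%:P) ^+ k) (('X - b%:P) ^+ l).
Proof.
move=> neq_ab; rewrite coprimep_expl // coprimep_expr //.
by rewrite coprimep_XsubC root_XsubC eq_sym.
Qed.

Lemma coprimep_XsubC_prod (F : fieldType) (a : F) (R : seq F) k n :
  a \notin R -> coprimep (('X - a%:P) ^+ k) (\prod_(b <- R) ('X - b%:P) ^+ n).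
Proof.
elim: R => [|b R IHR]; first by rewrite big_nil coprimep1.
rewrite inE negb_or big_cons coprimepMr => /andP [neq_ab aR].
by rewrite coprimep_XsubC_exp // IHR.
Qed.

Section Primary.
Variables (F : fieldType).

Lemma crt_XsubC (R : seq F) k (phi : F -> F) : uniq R ->
  exists P : {poly F},
    forall a, a \in R -> ('X - a%:P) ^+ k %| P - (phi a)%:P.
Proof.
elim: R => [|a R IHR] /=; first by exists 0.
case/andP => aR /IHR [P HP].
have [[u v] /= uv1] := Bezout_eq1_coprimepP _ _ (coprimep_XsubC_prod k k aR).
set Q := \prod_(b <- R) _ in uv1.
(* By Bezout [v * Q] is 1 modulo the power of ['X - a%:P], while [Q] is divisible by the powers
   attached to [R]: the correction fixes the value at [a] and preserves the others. *)
exists (P + ((phi a)%:P - P) * (v * Q)) => b; rewrite inE.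
case: (eqVneq b a) => [-> _|_ /= bR].
  have -> : P + ((phi a)%:P - P) * (v * Q) - (phi a)%:P =
     (P - (phi a)%:P) * (u * ('X - a%:P) ^+ k).
    by rewrite -[u * _](addrK (v * Q)) uv1; ring.
  by rewrite !dvdp_mull.
rewrite addrAC dvdp_add ?HP // !dvdp_mull //.
by rewrite /Q (big_rem _ bR) /= dvdp_mulr.
Qed.

(** Primary decomposition as an induction principle: Bezout splits a vector killed by the product
    into generalized eigenvectors. *)
Lemma primary_ind (L : vectType F) (T : 'End(L)) (R : seq F) n (P : L -> Prop) :
  uniq R -> P 0 -> (forall u v, P u -> P v -> P (u + v)) ->
  (forall a v, a \in R -> pact T (('X - a%:P) ^+ n) v = 0 -> P v) ->
  forall v, pact T (\prod_(a <- R) ('X - a%:P) ^+ n) v = 0 -> P v.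
Proof.
move=> uR P0 PD; elim: R uR => [_ _ v|a R IHR /= /andP [aR uR] HR v].
  by rewrite big_nil -polyC1 pactC scale1r => ->.
rewrite big_cons; have := coprimep_XsubC_prod n n aR.
set Q := \prod_(b <- R) _ => cop QV.
have [[b c] /= bc1] := Bezout_eq1_coprimepP _ _ cop.
rewrite -[v]scale1r -(pactC T) polyC1 -bc1 pactD; apply: PD.
  apply: IHR => // [x u xR|]; first by apply: HR; rewrite inE xR orbT.
  by rewrite -pactM mulrCA (mulrC Q) pactM QV linear0.
apply: (HR a); first by rewrite inE eqxx.
by rewrite -pactM mulrCA pactM QV linear0.
Qed.

End Primary.

(** The number of roots of an annihilating polynomial, counted with multiplicity, serves as a common
    exponent for its distinct roots. *)
Lemma annihilating_split_poly (F : closedFieldType) (L : vectType F) (T : 'End(L)) :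
  exists R : seq F, exists2 n, uniq R &
    forall v, pact T (\prod_(a <- R) ('X - a%:P) ^+ n) v = 0.
Proof.
have [p nzp pT0] := annihilating_poly T.
have [s Dp] := closed_field_poly_normal p.
exists (undup s), (size s); first exact: undup_uniq.
move=> v; apply: pact_dvdp (pT0 v); rewrite {}Dp.
rewrite dvdpZl ?lead_coef_eq0 // prodrXl.
suff dvd_sub t : {subset t <= undup s} ->
    \prod_(a <- t) ('X - a%:P) %| (\prod_(a <- undup s) ('X - a%:P)) ^+ size t.
  by apply: dvd_sub => x; rewrite mem_undup.
elim: t => [|a t IHt] sub_s; first by rewrite big_nil dvd1p.
rewrite big_cons exprS dvdp_mul //.
  have ua : a \in undup s by rewrite sub_s // inE eqxx.
  by rewrite (big_rem _ ua) /= dvdp_mulr.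
by apply: IHt => x xt; rewrite sub_s // inE xt orbT.
Qed.

Lemma shift_nilpotent (F : closedFieldType) (L : vectType F) (h g : 'End(L)) (c : F) :
  [pchar F] =i pred0 -> c != 0 ->
  (forall v, h (g v) = g (h v) + c *: g v) ->
  exists n, forall v, iter n g v = 0.
Proof.
move=> F0 nzc hg; have [R [n uR annR]] := annihilating_split_poly h.
exists (size R) => v; apply: (primary_ind (P := fun u => iter (size R) g u = 0) uR _ _ _ (annR v)).
- exact: linear0.
- by move=> u w u0 w0; rewrite linearD /= u0 w0 addr0.
move=> a u aR u0.
(* The [size R + 1] values [a + c *+ k] are distinct in characteristic 0, so one of them is not in
   [R]; its generalized eigenspace, which contains [iter k g u], is zero. *)
have [k le_kR kR] : exists2 k, (k <= size R)%N & a + c *+ k \notin R.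
  pose s := [seq a + c *+ k | k <- iota 0 (size R).+1].
  have us : uniq s.
    rewrite map_inj_uniq ?iota_uniq // => i j /addrI /eqP.
    rewrite -subr_eq0; wlog le_ij : i j / (i <= j)%N.
      move=> IH; case/orP: (leq_total i j) => [/IH //|/IH].
      by rewrite -[_ == 0]oppr_eq0 opprB => H /H.
    rewrite -oppr_eq0 opprB -mulrnBr // -mulr_natr mulf_eq0 (negPf nzc) /=.
    by move/pcharf0P: F0 => -> /eqP; lia.
  have : ~~ all (mem R) s.
    by apply/negP => /allP /(uniq_leq_size us); rewrite size_map size_iota ltnn.
  case/allPn => _ /mapP [k kR ->] akR; exists k => //.
  by move: kR; rewrite mem_iota ltnS.
rewrite -(subnK le_kR) iterD (_ : iter k g u = 0) ?linear0 //.
apply: (pact_coprime (coprimep_XsubC_prod n n kR)); last exact: annR.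
have := pact_shift (g := iter k g) (('X - a%:P) ^+ n) u (iter_shift k ^~ hg).
rewrite u0 linear0 rmorphXn /= comp_polyB comp_polyX comp_polyC.
by rewrite -addrA -opprD -polyCD (addrC (c *+ k)) => <-.
Qed.

Lemma natr_eq0_pchar0 (F : fieldType) (F0 : [pchar F] =i pred0) n :
  (n%:R == 0 :> F) = (n == 0)%N.
Proof. by move/pcharf0P: F0 => ->. Qed.

Lemma intr_eq0_pchar0 (F : fieldType) (F0 : [pchar F] =i pred0) (z : int) :
  (z%:~R == 0 :> F) = (z == 0).
Proof.
case: z => n; first by rewrite -pmulrn natr_eq0_pchar0.
by rewrite NegzE mulrNz oppr_eq0 -pmulrn natr_eq0_pchar0.
Qed.

(** * Weight decomposition of a representation of sl2 *)

Section Sl2Module.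
Variables (F : closedFieldType) (V : vectType F) (e f h : 'End(V)) (d : nat).
Hypothesis F0 : [pchar F] =i pred0.
Hypothesis ef : forall v, e (f v) = f (e v) + h v.
Hypothesis he : forall v, h (e v) = e (h v) + 2%:R *: e v.
Hypothesis hf : forall v, h (f v) = f (h v) + (- 2%:R) *: f v.
Hypothesis e_nil : exists n, forall v, iter n e v = 0.

Let natr_eq0_char0 := natr_eq0_pchar0 F0.
Let intr_eq0_char0 := intr_eq0_pchar0 F0.

Lemma sl2_f_nilpotent : exists n, forall v, iter n f v = 0.
Proof.
by apply: (shift_nilpotent F0 _ hf); rewrite oppr_eq0 natr_eq0_char0.
Qed.

(** Only integer eigenvalues are considered, and [h] is not assumed diagonalizable: that these
    spaces span [V] is the outcome of the section. *)
Definition wt (j : int) : {vspace V} := lker (h - j%:~R *: \1)%VF.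

Lemma mem_wt j v : (v \in wt j) = (h v == j%:~R *: v).
Proof. by rewrite memv_ker add_lfunE opp_lfunE scale_lfunE id_lfunE subr_eq0. Qed.

Lemma wt_e j v : v \in wt j -> e v \in wt (j + 2).
Proof.
rewrite !mem_wt he => /eqP ->.
by rewrite linearZ /= -scalerDl -[2%:R]/(2%:~R) -intrD.
Qed.

Lemma wt_f j v : v \in wt j -> f v \in wt (j - 2).
Proof.
rewrite !mem_wt hf => /eqP ->.
by rewrite linearZ /= -scalerDl -[2%:R]/(2%:~R) -mulrNz -intrD.
Qed.

Lemma wt_iter_e k j v : v \in wt j -> iter k e v \in wt (j + (2 * k)%:Z).
Proof.
move=> vj; elim: k => [|k IHk]; first by rewrite muln0 addr0.
by rewrite iterS (_ : _ + _ = j + (2 * k)%:Z + 2) ?wt_e //; lia.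
Qed.

Lemma wt_iter_f k j v : v \in wt j -> iter k f v \in wt (j - (2 * k)%:Z).
Proof.
move=> vj; elim: k => [|k IHk]; first by rewrite muln0 subr0.
by rewrite iterS (_ : _ - _ = j - (2 * k)%:Z - 2) ?wt_f //; lia.
Qed.

(** Stated for any vector, since it is applied below where [h] is not yet known to act by a
    scalar. *)
Lemma e_iter_f k v :
  e (iter k.+1 f v) = iter k.+1 f (e v) + k.+1%:R *: iter k f (h v - k%:R *: v).
Proof.
elim: k v => [|k IHk] v; first by rewrite /= ef scale0r subr0 scale1r.
rewrite iterS ef [e _]IHk linearD linearZ /=.
have -> : h (f (iter k f v)) = iter k.+1 f (h v) + (- 2%:R *+ k.+1) *: iter k.+1 f v.
  exact: (iter_shift k.+1 v hf).
rewrite -[f (iter k f (e v))]/(iter k.+1 f (e v)) -addrA; congr (_ + _).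
rewrite !linearB !linearZ /=.
have -> : f (iter k f (h v)) = iter k.+1 f (h v) by [].
have -> : f (iter k f v) = iter k.+1 f v by [].
rewrite !scalerN !scalerA -!scaleNr addrACA -{2}[iter k.+1 f (h v)]scale1r.
by rewrite -!scalerDl; congr (_ *: _ + _ *: _); ring.
Qed.

Lemma f_iter_e k v :
  f (iter k.+1 e v) = iter k.+1 e (f v) - k.+1%:R *: iter k e (h v + k%:R *: v).
Proof.
elim: k v => [|k IHk] v; first by rewrite /= scale0r addr0 scale1r ef addrK.
have fe u : f (e u) = e (f u) - h u by rewrite ef addrK.
rewrite iterS fe [f _]IHk linearB linearZ /=.
have -> : h (e (iter k e v)) = iter k.+1 e (h v) + (2%:R *+ k.+1) *: iter k.+1 e v.
  exact: (iter_shift k.+1 v he).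
rewrite -[e (iter k e (f v))]/(iter k.+1 e (f v)) -addrA; congr (_ + _).
rewrite -opprD; congr (- _); rewrite !linearD !linearZ /=.
have -> : e (iter k e (h v)) = iter k.+1 e (h v) by [].
have -> : e (iter k e v) = iter k.+1 e v by [].
rewrite !scalerA addrACA -{2}[iter k.+1 e (h v)]scale1r.
by rewrite -!scalerDl; congr (_ *: _ + _ *: _); ring.
Qed.

Lemma highest_string k j v : v \in wt j -> e v = 0 ->
  e (iter k.+1 f v) = (k.+1%:Z * (j - k%:Z))%:~R *: iter k f v.
Proof.
rewrite mem_wt => /eqP hv ev; rewrite e_iter_f ev linear0 add0r hv -scalerBl.
by rewrite linearZ /= scalerA intrM intrB.
Qed.

Lemma lowest_string k j v : v \in wt (- j) -> f v = 0 ->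
  f (iter k.+1 e v) = (k.+1%:Z * (j - k%:Z))%:~R *: iter k e v.
Proof.
rewrite mem_wt => /eqP hv fv; rewrite f_iter_e fv linear0 add0r hv -scalerDl.
rewrite [iter k e (_ *: _)]linearZ /= scalerA -scaleNr; congr (_ *: _).
by rewrite intrM intrB mulrNz -!pmulrn; ring.
Qed.

Lemma iter_e_lowest_neq0 (n k : nat) v : v \in wt (- n%:Z) -> f v = 0 -> v != 0 ->
  (k <= n)%N -> iter k e v != 0.
Proof.
move=> vn fv nzv; elim: k => // k IHk lt_kn.
apply: contra (IHk (ltnW lt_kn)) => /eqP ekv.
have := lowest_string k vn fv; rewrite ekv linear0 => /esym/eqP.
by rewrite scaler_eq0 intr_eq0_char0 mulf_eq0 => /orP [|//]; lia.
Qed.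

Lemma iter_ef_highest (k : nat) v : v \in wt d%:Z -> e v = 0 -> (k <= d)%N ->
  exists2 c : F, c != 0 & iter k e (iter k f v) = c *: v.
Proof.
move=> vd ev; elim: k => [|k IHk] lt_kd.
  by exists 1; rewrite ?oner_eq0 ?scale1r.
have [c nzc Dc] := IHk (ltnW lt_kd).
exists ((k.+1%:Z * (d%:Z - k%:Z))%:~R * c).
  by rewrite mulf_eq0 (negPf nzc) orbF intr_eq0_char0 mulf_eq0; lia.
by rewrite iterSr (highest_string _ vd ev) linearZ /= Dc scalerA.
Qed.

Hypothesis wt_gt_d : forall (j : int) v, (d%:Z < j)%R -> v \in wt j -> v = 0.

(** The last nonzero iterate of [v] under [f] has weight [- n] with [n > d]; applying [e] to it [n]
    times would give a nonzero vector of weight [n]. *)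
Lemma wt_lt_d (j : int) v : (j < - d%:Z)%R -> v \in wt j -> v = 0.
Proof.
move=> lt_jd vj; apply/eqP/negPn/negP => nzv.
have [N fN] := sl2_f_nilpotent.
have [p fp1 fp] : exists2 p, iter p.+1 f v = 0 & iter p f v != 0.
  have ex : exists n, iter n f v == 0 by exists N; rewrite fN.
  case: (ex_minnP ex) => [[|n]] /eqP fn0 min_n; first by rewrite (fn0 : v = 0) eqxx in nzv.
  by exists n => //; apply/negP => /min_n; rewrite ltnn.
have wp := wt_iter_f p vj; set w := iter p f v in fp wp.
have [n [Dn lt_dn]] : exists n : nat, j - (2 * p)%:Z = - n%:Z /\ (d < n)%N.
  by exists `|j - (2 * p)%:Z|%N; lia.
rewrite Dn in wp; have := iter_e_lowest_neq0 wp fp1 fp (leqnn n).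
by rewrite (wt_gt_d _ (wt_iter_e n wp)) ?eqxx //; lia.
Qed.

Definition wtsum : {vspace V} := (\sum_(i < (d + d).+1) wt (i%:Z - d%:Z))%VS.

Lemma wt_sub_sum j : (wt j <= wtsum)%VS.
Proof.
apply/subvP => v vj; case: (ltrP d%:Z j) => [dj|jd].
  by rewrite (wt_gt_d dj vj) mem0v.
case: (ltrP j (- d%:Z)) => [jd'|dj]; first by rewrite (wt_lt_d jd' vj) mem0v.
have lt_i : (absz (j + d%:Z)%R < (d + d).+1)%N by lia.
apply: subvP (sumv_sup (Ordinal lt_i) _ _) _ vj => //=.
by rewrite (_ : _ - _ = j) //; lia.
Qed.

Lemma wtsum_ind (P : V -> Prop) : P 0 -> (forall u v, P u -> P v -> P (u + v)) ->
  (forall (j : int) v, (- d%:Z <= j <= d%:Z)%R -> v \in wt j -> P v) ->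
  forall v, v \in wtsum -> P v.
Proof.
move=> P0 PD Pwt v /memv_sumP [u uwt ->].
apply: (big_ind P) => // i _; apply: Pwt (uwt i isT).
by have := ltn_ord i; lia.
Qed.

Lemma wtsum_e v : v \in wtsum -> e v \in wtsum.
Proof.
move: v; apply: wtsum_ind => [|u v Hu Hv|j v _ vj]; rewrite ?linear0 ?mem0v //.
  by rewrite linearD rpredD.
exact: subvP (wt_sub_sum _) _ (wt_e vj).
Qed.

Lemma wtsum_f v : v \in wtsum -> f v \in wtsum.
Proof.
move: v; apply: wtsum_ind => [|u v Hu Hv|j v _ vj]; rewrite ?linear0 ?mem0v //.
  by rewrite linearD rpredD.
exact: subvP (wt_sub_sum _) _ (wt_f vj).
Qed.

Lemma wtsum_h v : v \in wtsum -> h v \in wtsum.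
Proof.
move: v; apply: wtsum_ind => [|u v Hu Hv|j v _ vj]; rewrite ?linear0 ?mem0v //.
  by rewrite linearD rpredD.
have := vj; rewrite mem_wt => /eqP ->; rewrite rpredZ //.
exact: subvP (wt_sub_sum _) _ vj.
Qed.

(** The polynomial [p] vanishes at all the weights but the one of index [i], so [p] evaluated at [h]
    isolates [u i]. *)
Lemma wtsum_eq0 (u : 'I_(d + d).+1 -> V) :
  (forall i, u i \in wt (i%:Z - d%:Z)) -> \sum_i u i = 0 -> forall i, u i = 0.
Proof.
move=> uwt su i; pose p : {poly F} := \prod_(k < (d + d).+1 | k != i)
  ('X - (k%:Z - d%:Z)%:~R%:P).
have hu k : h (u k) = (k%:Z - d%:Z)%:~R *: u k by apply/eqP; rewrite -mem_wt.
have := congr1 (pact h p) su; rewrite linear0 linear_sum (bigD1 i) //= big1 => [|k ki].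
  rewrite addr0 (pact_eigen _ (hu i)) => /eqP; rewrite scaler_eq0 => /orP [|/eqP //].
  rewrite horner_prod; case/prodf_eq0 => k ki.
  rewrite hornerXsubC -intrB intr_eq0_char0 => /eqP k0.
  by case/eqP: ki; apply: val_inj => /=; lia.
rewrite (pact_eigen _ (hu k)) horner_prod (bigD1 k) //= hornerXsubC subrr.
by rewrite mul0r scale0r.
Qed.

(** Applying [e] gives the same relation for [e v], with [p] replaced by [p + q (j + 3)]. By
    induction on the nilpotency exponent [e v = 0], whence [p v = 0]. *)
Lemma fe_proportional_eq0 n (p q j : nat) v :
  iter n e v = 0 -> v \in wt j.+1%:Z -> (0 < p)%N ->
  p%:R *: v = - (q%:R *: f (e v)) -> v = 0.
Proof.
elim: n p q j v => // n IHn p q j v; rewrite iterSr => env vj p0 vE.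
have ev0 : e v = 0.
  apply: (IHn (p + q * j.+3)%N q j.+2) => //.
  - by have := wt_e vj; rewrite (_ : _ + _ = j.+3%:Z) //; lia.
  - by rewrite addn_gt0 p0.
  have {}vE : p%:R *: e v = - (q%:R *: (f (e (e v)) + h (e v))).
    by have := congr1 e vE; rewrite linearZ /= linearN linearZ /= ef.
  have := wt_e vj; rewrite mem_wt => /eqP he2.
  rewrite natrD scalerDl vE he2 scalerDr opprD -addrA scalerA.
  rewrite (_ : (j.+1%:Z + 2)%:~R = j.+3%:R :> F); last first.
    by rewrite (_ : _ + _ = j.+3%:Z) //; lia.
  by rewrite natrM addNr addr0.
move/eqP: vE; rewrite ev0 linear0 scaler0 oppr0 scaler_eq0 natr_eq0_char0.
by case/orP => [|/eqP //]; lia.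
Qed.

(** Here [f (e v) = - h v], which is the relation of [fe_proportional_eq0] for [p = j + 1] and
    [q = 1]. *)
Lemma ef_eq0 (j : nat) v : v \in wt j.+1%:Z -> e (f v) = 0 -> v = 0.
Proof.
move=> vj efv; have [n en] := e_nil.
apply: (@fe_proportional_eq0 n j.+1 1 j) => //.
move: vj; rewrite mem_wt => /eqP hv.
by apply/eqP; rewrite -subr_eq0 opprK scale1r addrC -[j.+1%:R *: v]hv -ef efv.
Qed.

Lemma iter_e_f_img k v : v \in wtsum -> iter k e (iter k.+1 f v) \in (f @: wtsum)%VS.
Proof.
elim: k v => [|k IHk] v Wv; first exact: memv_img.
rewrite iterSr e_iter_f; set w := f (e v) + k.+2%:R *: (h v - k.+1%:R *: v).
have -> : iter k.+2 f (e v) + k.+2%:R *: iter k.+1 f (h v - k.+1%:R *: v)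
  = iter k.+1 f w.
  by rewrite /w (iterSr k.+1 f (e v)) [in RHS]linearD; congr (_ + _); rewrite [RHS]linearZ.
apply: IHk; rewrite rpredD ?rpredZ ?rpredB ?rpredZ //.
- by rewrite wtsum_f // wtsum_e.
- exact: wtsum_h.
Qed.

Definition falling k : {poly F} := \prod_(i < k) ('X - i%:R%:P).

(** Moving one [e] through the powers of [f] leaves a term in [e v], absorbed by [iter_e_f_img], and
    a factor [(k + 1) (h - k)]. Once [f ^ k = 0], the lemma puts [falling k] of [h], applied to [v],
    in the image of [f]. *)
Lemma iter_e_f_falling k v : e v \in wtsum ->
  iter k e (iter k f v) - k`!%:R *: pact h (falling k) v \in (f @: wtsum)%VS.
Proof.
elim: k v => [|k IHk] v Wev.
  by rewrite /falling big_ord0 -polyC1 pactC !scale1r subrr mem0v.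
rewrite iterSr e_iter_f linearD linearZ /= -addrA rpredD //.
  exact: (iter_e_f_img k Wev).
have -> : k.+1`!%:R *: pact h (falling k.+1) v =
    k.+1%:R *: (k`!%:R *: pact h (falling k) (h v - k%:R *: v)).
  by rewrite /falling big_ord_recr /= pactM pactXsubC factS natrM scalerA.
rewrite -scalerBr rpredZ // IHk // linearB linearZ /= rpredB ?rpredZ //.
have -> : e (h v) = h (e v) - 2%:R *: e v by rewrite he addrK.
by rewrite rpredB ?rpredZ // wtsum_h.
Qed.

(** By induction [e v] is in [wtsum]. Then [v] is corrected by some [w1] in [wtsum] so that
    [falling N], a polynomial with simple integer roots, evaluated at [h] kills the difference. *)
Lemma ker_e_sub_wtsum k v : iter k e v = 0 -> v \in wtsum.
Proof.
elim: k v => [|k IHk] v; first by move=> /= ->; apply: mem0v.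
rewrite iterSr => /IHk Wev.
have [N fN] := sl2_f_nilpotent.
have [w Ww Dq] : exists2 w, w \in wtsum & pact h (falling N) v = f w.
  have := iter_e_f_falling N Wev; rewrite fN linear0 sub0r rpredN rpredZeq.
  rewrite natr_eq0_char0 eqn0Ngt fact_gt0 /= => /memv_imgP [w Ww ->].
  by exists w.
have /memv_sumP [u uwt Dw] := Ww; have {}uwt i : u i \in wt (i%:Z - d%:Z) by apply: uwt.
(* The scalar by which [falling N] of [h] acts on [f (u i)]. Where it is nonzero it can be inverted,
   and [w1] removes the component. *)
pose c (i : 'I_(d + d).+1) : F := (falling N).[(i%:Z - d%:Z - 2)%:~R].
pose w1 := \sum_(i | c i != 0) (c i)^-1 *: f (u i).
have fuwt i : f (u i) \in wt (i%:Z - d%:Z - 2) by apply: wt_f.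
have cu i : pact h (falling N) (f (u i)) = c i *: f (u i).
  by apply: pact_eigen; apply/eqP; rewrite -mem_wt.
have Ww1 : w1 \in wtsum.
  by apply: rpred_sum => i _; rewrite rpredZ //; apply: subvP (wt_sub_sum _) _ (fuwt i).
suff Wv1 : v - w1 \in wtsum by rewrite -(subrK w1 v) rpredD.
have Dv1 : pact h (falling N) (v - w1) = \sum_(i | c i == 0) f (u i).
  rewrite linearB /= Dq Dw linear_sum /= (bigID (fun i => c i == 0)) /=.
  rewrite -addrA [X in _ + X](_ : _ = 0) ?addr0 //.
  apply/eqP; rewrite subr_eq0; apply/eqP.
  rewrite /w1 (linear_sum (pact h (falling N))); apply: eq_bigr => i ci.
  by rewrite linearZ /= cu scalerA mulVf // scale1r.
have Wev1 : e (v - w1) \in wtsum by rewrite linearB rpredB // wtsum_e.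
(* If [c i] vanishes, [f (u i)] has a weight among [0, ..., N - 1], so the weight of [u i] is at
   least 2 and [ef_eq0] applies to it. *)
have c0P i : c i == 0 -> exists j : nat, i%:Z - d%:Z = j.+2%:Z.
  rewrite /c /falling horner_prod => /prodf_eq0 [l _].
  rewrite hornerXsubC (pmulrn _ l) -intrB intr_eq0_char0 => /eqP l0.
  by exists l; lia.
have /memv_sumP [z zwt Dz] := Wev1.
have {}zwt i : z i \in wt (i%:Z - d%:Z) by apply: zwt.
(* The image under [e] of [falling N] of [h] at [v - w1] is computed in two ways: from [Dv1], and by
   moving [e] past [h], which shifts [h] by 2. The vectors [y i] are the differences, weight by
   weight. *)
pose y i := (if c i == 0 then e (f (u i)) else 0) - c i *: z i.
have y0 : forall i, y i = 0.
  apply: wtsum_eq0 => [i|].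
    rewrite rpredB ?rpredZ //; case: ifP => _; last exact: mem0v.
    by have := wt_e (fuwt i); rewrite subrK.
  rewrite sumrB -big_mkcond /=.
  have -> : \sum_(i | c i == 0) e (f (u i)) =
      pact h (falling N \Po ('X - 2%:R%:P)) (\sum_i z i).
    rewrite -Dz; transitivity (e (pact h (falling N) (v - w1))).
      by rewrite Dv1 linear_sum.
    exact: (pact_shift _ _ he).
  rewrite (linear_sum (pact _ _)).
  apply/eqP; rewrite subr_eq0; apply/eqP; apply: eq_bigr => i _.
  have /eqP hz : h (z i) == (i%:Z - d%:Z)%:~R *: z i by rewrite -mem_wt.
  rewrite /= (pact_eigen _ hz) horner_comp hornerXsubC /c.
  by rewrite [in RHS]intrB.
have u0 i : c i == 0 -> u i = 0.
  move=> ci; have [j Dj] := c0P i ci; have := y0 i.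
  rewrite /y ci (eqP ci) scale0r subr0; apply: ef_eq0 j.+1 _ _.
  by rewrite -Dj.
have pv1 : pact h (falling N) (v - w1) = 0.
  by rewrite Dv1 big1 // => i ci; rewrite u0 // linear0.
(* The roots of [falling N] are simple, so the primary components of [v - w1] are genuine
   eigenvectors with integer eigenvalues. *)
have falE : falling N = \prod_(a <- [seq i%:R | i <- iota 0 N]) ('X - a%:P) ^+ 1.
  rewrite /falling -(big_mkord xpredT (fun i => 'X - i%:R%:P)) /index_iota subn0 big_map.
  by apply: eq_bigr => i _; rewrite expr1.
rewrite falE in pv1.
apply: (primary_ind (P := fun x => x \in wtsum) _ _ _ _ pv1).
- rewrite map_inj_uniq ?iota_uniq // => i j /eqP; rewrite -subr_eq0 !pmulrn -intrB.
  by rewrite intr_eq0_char0 => /eqP; lia.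
- exact: mem0v.
- by move=> x1 x2; apply: rpredD.
move=> _ x /mapP [i _ ->]; rewrite expr1 pactXsubC pmulrn => /eqP.
by rewrite subr_eq0 -mem_wt; apply: (subvP (wt_sub_sum _)).
Qed.

Lemma wt_ind (P : V -> Prop) : P 0 -> (forall u v, P u -> P v -> P (u + v)) ->
  (forall (j : int) v, (- d%:Z <= j <= d%:Z)%R -> v \in wt j -> P v) -> forall v, P v.
Proof.
move=> P0 PD Pwt v; apply: wtsum_ind => //.
by have [n en] := e_nil; apply: ker_e_sub_wtsum (en v).
Qed.

End Sl2Module.

(** * Cyclotomic polynomials and conjugate roots of unity *)

Lemma Cyclotomic_dvdp_or_coprimep n (p : {poly int}) : (0 < n)%N ->
  let toQ := map_poly (intr : int -> rat) in
  toQ 'Phi_n %| toQ p \/ coprimep (toQ p) (toQ 'Phi_n).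
Proof.
move=> n0 toQ; case: (boolP (toQ 'Phi_n %| toQ p)) => [|ndv]; [by left | right].
pose toC := map_poly (ratr : rat -> algC).
have toCQ q : toC (toQ q) = map_poly intr q.
  by rewrite /toC /toQ -map_poly_comp; apply: eq_map_poly => a; rewrite /= ratr_int.
rewrite -(coprimep_map (ratr : {rmorphism rat -> algC})).
(* A common root in [algC] is a primitive [n]-th root of unity; its minimal polynomial is ['Phi_n],
   which therefore divides [p]. *)
apply: Pdiv.ClosedField.root_coprimep => x px; apply: contra ndv => Phix.
have [z prim_z] := C_prim_root_exists n0.
have prim_x : n.-primitive_root x.
  by rewrite -(root_cyclotomic prim_z) -(Cintr_Cyclotomic prim_z) -toCQ.
have [q [Dq _] qP] := minCpolyP x.
suff <- : q = toQ 'Phi_n by rewrite -qP.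
apply: (map_inj_poly (fmorph_inj (ratr : {rmorphism rat -> algC}))); first exact: rmorph0.
by rewrite -Dq (minCpoly_cyclotomic prim_x) -(Cintr_Cyclotomic prim_x) -toCQ.
Qed.

Section PrimitiveRoots.
Variable F : fieldType.
Hypothesis F0 : [pchar F] =i pred0.
Local Notation toF := (map_poly (intr : int -> F)).

Lemma root_Cyclotomic n (z : F) : n.-primitive_root z -> root (toF 'Phi_n) z.
Proof.
move=> prim_z; have n0 := prim_order_gt0 prim_z.
have : root (toF (\prod_(k <- divisors n) 'Phi_k)) z.
  rewrite prod_Cyclotomic // rmorphB rmorph1 /= map_polyXn.
  by rewrite rootE !hornerE prim_expr_order // subrr.
rewrite rmorph_prod rootE horner_prod prodf_seq_eq0 => /hasP [k].
rewrite -dvdn_divisors // => kn /= zk.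
have k0 := dvdn_gt0 n0 kn.
have : (toF ('X^k - 1)).[z] == 0.
  rewrite -prod_Cyclotomic // (big_rem k) /= ?rmorphM ?hornerM /=.
    by rewrite (eqP zk) mul0r.
  by rewrite -dvdn_divisors.
rewrite rmorphB rmorph1 /= map_polyXn !hornerE subr_eq0 -(prim_order_dvd prim_z) => nk.
have -> // : n = k by apply/eqP; rewrite eqn_dvd nk kn.
Qed.

(* The content is the irreducibility of the cyclotomic polynomial over the rationals. *)
Lemma root_primitive_conj n (z w : F) (p : {poly int}) :
  n.-primitive_root z -> n.-primitive_root w -> root (toF p) z -> root (toF p) w.
Proof.
move=> prim_z prim_w pz; have n0 := prim_order_gt0 prim_z.
have toQ_inj : injective (map_poly (intr : int -> rat)).
  by apply: map_inj_poly => //; apply: intr_inj.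
have horner_toF (q r : {poly int}) x : (toF (q * r)).[x] = (toF q).[x] * (toF r).[x].
  by rewrite rmorphM hornerM.
have nzF (a : int) : a != 0 -> a%:~R != 0 :> F by rewrite intr_eq0_pchar0.
case: (Cyclotomic_dvdp_or_coprimep p n0) => [/dvdpP [q Dq]|].
  have [r [a nza Dr]] := rat_poly_scale q.
  have Dp : a *: p = r * 'Phi_n.
    apply: toQ_inj; rewrite rmorphM map_polyZ /= Dq Dr -scalerAl scalerA.
    by rewrite divff ?scale1r // intr_eq0.
  have /eqP := horner_toF r 'Phi_n w.
  rewrite -Dp map_polyZ hornerZ (rootP (root_Cyclotomic prim_w)) mulr0.
  by rewrite mulf_eq0 (negPf (nzF _ nza)).
move=> /Bezout_eq1_coprimepP [[u v] /= uv1].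
have [r [a nza Dr]] := rat_poly_scale u.
have [s [b nzb Ds]] := rat_poly_scale v.
(* Clearing denominators in the Bezout relation produces a nonzero integer that would vanish in [F]
   after evaluation at [z]. *)
have Dab : (b *: r) * p + (a *: s) * 'Phi_n = (a * b)%:P.
  apply: toQ_inj; rewrite rmorphD !rmorphM /= !map_polyZ !map_polyC /=.
  have -> : map_poly intr r = a%:~R *: u by rewrite Dr scalerA divff ?scale1r ?intr_eq0.
  have -> : map_poly intr s = b%:~R *: v by rewrite Ds scalerA divff ?scale1r ?intr_eq0.
  rewrite !scalerA (mulrC b%:~R) -!scalerAl -scalerDr uv1.
  by rewrite -mul_polyC mulr1 polyCM.
have := congr1 (fun q => (toF q).[z]) Dab.
rewrite /= rmorphD hornerD !horner_toF (rootP pz) (rootP (root_Cyclotomic prim_z)).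
rewrite !mulr0 addr0 map_polyC hornerC => /esym/eqP.
by rewrite (negPf (nzF _ _)) // mulf_neq0.
Qed.

(** If the system at [w] had only the zero solution, some maximal minor would be nonzero at [w].
    This minor is an integer polynomial, hence nonzero at [z] too by conjugation, and the system at
    [z] would have only the zero solution. *)
Lemma linear_system_conj n (z w : F) k r (M : 'M[{poly int}]_(k, r)) :
  n.-primitive_root z -> n.-primitive_root w ->
  let ev x := map_mx (fun p => (toF p).[x]) M in
  (exists2 u : 'cV[F]_r, u != 0 & ev z *m u = 0) ->
  exists2 u : 'cV[F]_r, u != 0 & ev w *m u = 0.
Proof.
move=> prim_z prim_w ev [u nzu zu].
case: (boolP (row_full (ev w))) => [full|nfull]; last first.
  have : kermx (ev w)^T != 0.
    rewrite kermx_eq0 /row_free mxrank_tr; apply: contra nfull.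
    by rewrite /row_full.
  rewrite -nz_row_eq0 => nzk; exists (nz_row (kermx (ev w)^T))^T.
    by rewrite -trmx0 (inj_eq trmx_inj).
  by apply: trmx_inj; rewrite trmx_mul trmxK trmx0; apply/sub_kermxP/nz_row_sub.
pose g := fullrankfun full; pose D := \det (rowsub g M).
have detE x : \det (rowsub g (ev x)) = (toF D).[x].
  pose evx := (horner_eval x \o toF : {rmorphism {poly int} -> F}).
  rewrite -[RHS]/(evx D) -det_map_mx; congr (\det _).
  by apply/matrixP => i j; rewrite !mxE.
have : ~~ root (toF D) w.
  by have := fullrowsub_unit full; rewrite unitmxE unitfE detE.
case/negP; apply: (root_primitive_conj prim_z prim_w).
rewrite rootE -detE -[_ == 0]negbK -unitfE -unitmxE; apply: contra nzu => ug.
apply/eqP; rewrite -(mulKmx ug u).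
have -> : rowsub g (ev z) *m u = rowsub g (ev z *m u).
  by apply/matrixP => i j; rewrite !mxE; apply: eq_bigr => l _; rewrite !mxE.
by rewrite zu; apply/matrixP => i j; rewrite !mxE big1 // => l _; rewrite !mxE mulr0.
Qed.

(* The additive relations among the elements of [R] together with their
   behaviour under multiplication by [z] form a linear system over [Z[z]]. *)
Lemma additive_twist n (z w : F) (R : seq F) : uniq R ->
  n.-primitive_root z -> n.-primitive_root w ->
  (exists2 a, a \in R & a != 0) -> {homo *%R z : a / a \in R} ->
  exists phi : F -> F, [/\ exists2 a, a \in R & phi a != 0,
    {in R, forall a, phi (z * a) = w * phi a} &
    forall a b, a \in R -> b \in R -> a + b \in R -> phi (a + b) = phi a + phi b].
Proof.
move=> uR prim_z prim_w [a0 Ra0 nza0] Rz; set r := size R.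
pose c (i j : 'I_r) : {poly int} := (i == j)%:R.
pose T := (('I_r * 'I_r * 'I_r) + ('I_r * 'I_r))%type.
pose row (t : T) (l : 'I_r) : {poly int} := match t with
  | inl (i, j, k) => if R`_i + R`_j == R`_k then c i l + c j l - c k l else 0
  | inr (i, j) => if z * R`_i == R`_j then c j l - 'X * c i l else 0
  end.
pose M := \matrix_(t < #|{: T}|, l < r) row (enum_val t) l.
have sumc x (u : 'cV[F]_r) i : \sum_l (toF (c i l)).[x] * u l 0 = u i 0.
  rewrite (bigD1 i) //= big1 => [|l li].
    by rewrite /c eqxx rmorph1 hornerC mul1r addr0.
  by rewrite /c eq_sym (negPf li) rmorph0 horner0 mul0r.
have rowE x (u : 'cV[F]_r) t : \sum_l (toF (row t l)).[x] * u l 0 = match t with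
  | inl (i, j, k) => if R`_i + R`_j == R`_k then u i 0 + u j 0 - u k 0 else 0
  | inr (i, j) => if z * R`_i == R`_j then u j 0 - x * u i 0 else 0 end.
  have s0 : \sum_(l < r) (toF 0).[x] * u l 0 = 0.
    by rewrite big1 // => l _; rewrite rmorph0 horner0 mul0r.
  case: t => [[[i j] k]|[i j]] /=; case: ifP => _ //.
    rewrite -(sumc x u i) -(sumc x u j) -(sumc x u k) -big_split -sumrB /=.
    by apply: eq_bigr => l _; 
    rewrite rmorphB rmorphD /= !hornerD hornerN mulrBl mulrDl.
  rewrite -(sumc x u j) -(sumc x u i) mulr_sumr -sumrB.
  by apply: eq_bigr => l _; 
    rewrite rmorphB rmorphM /= map_polyX hornerD hornerN hornerM hornerX mulrBl mulrA.
have kerP x (u : 'cV[F]_r) : map_mx (fun p => (toF p).[x]) M *m u = 0 <->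
  forall t, \sum_l (toF (row t l)).[x] * u l 0 = 0.
  split=> [/matrixP ux t|ux].
    have := ux (enum_rank t) 0; rewrite !mxE; apply: etrans.
    by apply: eq_bigr => l _; rewrite !mxE enum_rankK.
  apply/matrixP => i j; rewrite ord1 !mxE; apply: etrans (ux (enum_val i)).
  by apply: eq_bigr => l _; rewrite !mxE.
have idx a (Ra : a \in R) : (index a R < r)%N by rewrite index_mem.
have [|u nzu /kerP wu] := linear_system_conj (M := M) prim_z prim_w.
  (* At [z] the identity map of [R] solves the system; it is nonzero because of [a0]. *)
  exists (\col_i R`_i).
    apply: contra nza0 => /eqP/colP/(_ (Ordinal (idx a0 Ra0))).
    by rewrite !mxE nth_index // => ->.
  apply/kerP => t; rewrite rowE; case: t => [[[i j] k]|[i j]] /=; rewrite !mxE.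
    by case: eqP => // ->; rewrite subrr.
  by case: eqP => // ->; rewrite subrr.
pose phi a := if insub (index a R) is Some i then u i 0 else 0.
have phiE a (Ra : a \in R) : phi a = u (Ordinal (idx a Ra)) 0.
  by rewrite /phi (insubT (fun i => i < r)%N (idx a Ra)).
have nthE a (Ra : a \in R) : R`_(Ordinal (idx a Ra)) = a by rewrite /= nth_index.
exists phi; split.
- have [i nzi] : exists i, u i 0 != 0.
    by apply/existsP; apply: contraR nzu => /existsPn u0; apply/eqP/colP => i;
      rewrite mxE; apply/eqP; have := u0 i; rewrite negbK.
  exists R`_i; first exact: mem_nth.
  rewrite phiE ?mem_nth // => Ri; rewrite (_ : Ordinal _ = i) //.
  by apply: val_inj; rewrite /= index_uniq.
- move=> a Ra; have Rza := Rz a Ra; rewrite !phiE //.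
  have := wu (inr (Ordinal (idx a Ra), Ordinal (idx _ Rza))).
  by rewrite rowE !nthE eqxx => /eqP; rewrite subr_eq0 => /eqP.
move=> a b Ra Rb Rab; rewrite !phiE.
have := wu (inl (Ordinal (idx a Ra), Ordinal (idx b Rb), Ordinal (idx _ Rab))).
by rewrite rowE !nthE eqxx => /eqP; rewrite subr_eq0 => /eqP.
Qed.

End PrimitiveRoots.

Lemma closed_prim_root_exists (F : closedFieldType) (F0 : [pchar F] =i pred0) n :
  (0 < n)%N -> exists z : F, n.-primitive_root z.
Proof.
move=> n_gt0; pose p : {poly F} := 'X^n - 1.
have [r Dp] := closed_field_poly_normal p.
rewrite (monicP _) ?monicXnsubC // scale1r in Dp.
have rn1 : all n.-unity_root r by apply/allP => z; rewrite -root_prod_XsubC -Dp.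
have sz_r : (n < (size r).+1)%N.
  by rewrite -(size_prod_XsubC r id) -Dp size_XnsubC.
have [|z] := hasP (has_prim_root n_gt0 rn1 _ sz_r); last by exists z.
by rewrite -separable_prod_XsubC -Dp separable_Xn_sub_1 // natr_eq0_pchar0 // -lt0n.
Qed.

(** * Interpolation compatible with multiplication by a root of unity *)

Section TwistedInterpolation.
Variables (F : fieldType) (m : nat) (z w : F) (R : seq F) (phi : F -> F).
Hypotheses (F0 : [pchar F] =i pred0) (uR : uniq R).
Hypotheses (m_gt0 : (0 < m)%N) (wm : w ^+ m = 1) (zm : z ^+ m = 1).
Hypothesis Rz : {homo *%R z : a / a \in R}.
Hypothesis phi_z : {in R, forall a, phi (z * a) = w * phi a}.

Lemma phi_expr k a : a \in R -> z ^+ k * a \in R /\ phi (z ^+ k * a) = w ^+ k * phi a.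
Proof.
move=> Ra; elim: k => [|k [Rk phik]]; first by rewrite !mul1r.
by rewrite !exprS -!mulrA phi_z ?Rz // phik.
Qed.

Lemma coef_comp_scaleX (p : {poly F}) c i : (p \Po (c *: 'X))`_i = p`_i * c ^+ i.
Proof.
elim/poly_ind: p i => [|p a IHp] i; first by rewrite comp_poly0 !coef0 mul0r.
rewrite comp_poly_MXaddC -scalerAr !coefD !coefC coefZ !coefMX.
by case: i => [|i] /=; rewrite ?IHp ?mulr0 ?mulr1 ?addr0 // exprS; ring.
Qed.

(* Averaging the interpolation polynomial over the cyclic group generated by [z]
   isolates its part supported on the exponents [i] with [z ^+ i = w]. *)
Lemma twisted_interpolation K : exists P : {poly F},
  (forall i, P`_i != 0 -> z ^+ i = w) /\
  (forall a, a \in R -> ('X - a%:P) ^+ K %| P - (phi a)%:P).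
Proof.
have [Q HQ] := crt_XsubC K phi uR.
have nzw : w != 0.
  by apply: contra_eq_neq wm => ->; rewrite expr0n eqn0Ngt m_gt0 eq_sym oner_eq0.
have nzz : z != 0.
  by apply: contra_eq_neq zm => ->; rewrite expr0n eqn0Ngt m_gt0 eq_sym oner_eq0.
have nzm : m%:R != 0 :> F by rewrite natr_eq0_pchar0 // -lt0n.
pose P := m%:R^-1 *: \sum_(k < m) (w ^+ k)^-1 *: (Q \Po (z ^+ k *: 'X)).
exists P; split=> [i|a Ra].
  apply: contraNeq => neq_zw; rewrite coefZ coef_sum.
  have -> : \sum_(k < m) ((w ^+ k)^-1 *: (Q \Po (z ^+ k *: 'X)))`_i =
      Q`_i * \sum_(k < m) (z ^+ i / w) ^+ k.
    rewrite mulr_sumr; apply: eq_bigr => k _.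
    rewrite coefZ coef_comp_scaleX exprMn exprVn -!exprM (mulnC k) mulrC -mulrA.
    by [].
  (* The ratio [z ^+ i / w] is an [m]-th root of unity other than 1, so its geometric sum is
     zero. *)
  have : (z ^+ i / w) ^+ m - 1 = 0.
    by rewrite exprMn exprVn wm -exprM mulnC exprM zm expr1n invr1 mulr1 subrr.
  rewrite subrX1 => /eqP; rewrite mulf_eq0 => /orP [|/eqP ->]; last by rewrite !mulr0.
  rewrite subr_eq0 => /eqP zw; case/eqP: neq_zw.
  by rewrite -[LHS](divfK nzw) zw mul1r.
have -> : P - (phi a)%:P = m%:R^-1 *:
    \sum_(k < m) (w ^+ k)^-1 *: ((Q - (phi (z ^+ k * a))%:P) \Po (z ^+ k *: 'X)).
  have -> : (phi a)%:P = m%:R^-1 *: \sum_(k < m) (phi a)%:P.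
    by rewrite sumr_const card_ord -scaler_nat scalerA mulVf // scale1r.
  rewrite -scalerBr -sumrB; congr (_ *: _); apply: eq_bigr => k _.
  rewrite comp_polyB comp_polyC scalerBr; congr (_ - _).
  have [_ ->] := phi_expr k Ra.
  by rewrite polyCM -mul_polyC mulrA -polyCM mulVf ?expf_neq0 // mul1r.
rewrite -mul_polyC dvdp_mull //; apply: (big_ind (fun q => _ %| q)).
- exact: dvdp0.
- by move=> p q; apply: dvdp_add.
move=> k _; rewrite -mul_polyC dvdp_mull //.
have [Rk _] := phi_expr k Ra.
apply: dvdp_trans (dvdp_comp_poly _ (HQ _ Rk)).
rewrite rmorphXn /= comp_polyB comp_polyX comp_polyC dvdp_exp2r //.
by rewrite polyCM -mul_polyC -mulrBr dvdp_mull.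
Qed.

End TwistedInterpolation.

(** * Traces and eigenvalues *)

Lemma mxtrace_eigenvalues (F : closedFieldType) n (A : 'M[F]_n) :
  exists2 rs : seq F, rs =i eigenvalue A & \tr A = \sum_(a <- rs) a.
Proof.
have [rs Drs] := closed_field_poly_normal (char_poly A).
rewrite (monicP (char_poly_monic A)) scale1r in Drs.
exists rs => [a|].
  by rewrite -[RHS]/(eigenvalue A a) eigenvalue_root_char Drs root_prod_XsubC.
have sz : size rs = n.
  by apply: succn_inj; rewrite -(size_char_poly A) Drs size_prod_XsubC.
case: n A Drs sz => [|n] A Drs sz.
  by rewrite (size0nil sz) big_nil /mxtrace big_ord0.
apply: oppr_inj; rewrite -char_poly_trace // Drs /=.
by rewrite -[n]/(n.+1.-1) -sz coefPn_prod_XsubC // sz.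
Qed.

Section LinearTrace.
Variables (F : closedFieldType) (V : vectType F).
Implicit Types f g : 'End(V).

Definition trl f : F := \tr (f2mx f).

Lemma f2mxE f v : v2r (f v) = v2r v *m f2mx f.
Proof. by rewrite unlock /= r2vK. Qed.

Lemma f2mx_eq f (A : 'M_(dim V)) : (forall v, v2r (f v) = v2r v *m A) -> f2mx f = A.
Proof.
move=> fA; apply/row_matrixP => i.
by rewrite !rowE -[delta_mx _ _](r2vK) -f2mxE fA.
Qed.

Lemma trl_eq f g : (forall v, f v = g v) -> trl f = trl g.
Proof. by move=> fg; congr trl; apply/lfunP. Qed.

Lemma trlD f g : trl (f + g) = trl f + trl g.
Proof.
rewrite /trl -mxtraceD; congr (\tr _); apply: f2mx_eq => v.
by rewrite add_lfunE linearD /= !f2mxE mulmxDr.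
Qed.

Lemma trlZ a f : trl (a *: f) = a * trl f.
Proof.
rewrite /trl -mxtraceZ; congr (\tr _); apply: f2mx_eq => v.
by rewrite scale_lfunE linearZ /= !f2mxE scalemxAr.
Qed.

Lemma f2mx_comp f g : f2mx (f \o g)%VF = f2mx g *m f2mx f.
Proof. by apply: f2mx_eq => v; rewrite comp_lfunE !f2mxE mulmxA. Qed.

Lemma trl_comp f g : trl (f \o g)%VF = trl (g \o f)%VF.
Proof. by rewrite /trl !f2mx_comp mxtrace_mulC. Qed.

Lemma trl_eigenvalues f : exists2 rs : seq F,
  (forall a, a \in rs <-> exists2 v, f v = a *: v & v != 0) &
  trl f = \sum_(a <- rs) a.
Proof.
have [rs rsE trE] := mxtrace_eigenvalues (f2mx f); exists rs => // a.
rewrite rsE; split=> [/eigenvalueP [u uA nzu]|[v fv nzv]]; last first.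
  apply/eigenvalueP; exists (v2r v); first by rewrite -f2mxE fv linearZ.
  by rewrite (can2_eq v2rK r2vK) linear0.
exists (r2v u); last by rewrite (can2_eq r2vK v2rK) linear0.
by apply: (can_inj v2rK); rewrite f2mxE r2vK uA linearZ /= r2vK.
Qed.

Lemma trl_nilpotent f n : (forall v, iter n f v = 0) -> trl f = 0.
Proof.
move=> fn0; have [rs rsP ->] := trl_eigenvalues f.
rewrite big_seq big1 // => a /rsP [v fv nzv]; apply/eqP.
have: iter n f v = a ^+ n *: v.
  by elim: n {fn0} => [|n IHn]; rewrite ?scale1r // iterS IHn linearZ /= fv scalerA exprSr.
rewrite fn0 => /esym/eqP; rewrite scaler_eq0 (negPf nzv) orbF expf_eq0.
by case/andP.
Qed.

End LinearTrace.

(** * Lie brackets and the Killing form *)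

Section LieBasics.
Variables (F : closedFieldType) (L : vectType F) (br : L -> L -> L).
Hypothesis Hlie : lie_bracket br.

Fact br_is_linear x : linear (br x).
Proof. by case: Hlie => _ brr _ _ a u v; rewrite brr. Qed.
HB.instance Definition _ x := GRing.isLinear.Build F L L _ (br x) (br_is_linear x).

Definition ad x : 'End(L) := linfun (br x).

Lemma adE x y : ad x y = br x y. Proof. by rewrite lfunE. Qed.

Lemma br_xx x : br x x = 0. Proof. by case: Hlie. Qed.

Lemma br_linl a x y z : br (a *: x + y) z = a *: br x z + br y z.
Proof. by case: Hlie => ->. Qed.

Lemma br_anti x y : br x y = - br y x.
Proof.
apply/eqP; rewrite -addr_eq0; apply/eqP; have := br_xx (1 *: x + y).
by rewrite br_linl !scale1r !linearD /= !br_xx addr0 add0r.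
Qed.

Lemma brDl x y z : br (x + y) z = br x z + br y z.
Proof. by rewrite br_anti linearD opprD -!(br_anti _ z). Qed.

Lemma brZl a x z : br (a *: x) z = a *: br x z.
Proof. by rewrite br_anti linearZ -scalerN -br_anti. Qed.

Lemma brNl x z : br (- x) z = - br x z.
Proof. by rewrite -scaleN1r brZl scaleN1r. Qed.

Lemma br0l z : br 0 z = 0.
Proof. by rewrite br_anti linear0 oppr0. Qed.

Lemma jacobi x y z : br x (br y z) = br (br x y) z + br y (br x z).
Proof.
case: Hlie => _ _ _ /(_ x y z) /eqP; rewrite -addrA addr_eq0 => /eqP ->.
rewrite opprD addrC; congr (_ + _); first by rewrite -br_anti.
by rewrite -linearN -br_anti.
Qed.

Lemma iter_ad n x y : iter n (ad x) y = iter n (br x) y.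
Proof. by elim: n => //= n ->; rewrite adE. Qed.

Definition kappa x y : F := trl (ad x \o ad y)%VF.

Lemma kappa_sym x y : kappa x y = kappa y x.
Proof. exact: trl_comp. Qed.

Lemma kappaDr x y z : kappa x (y + z) = kappa x y + kappa x z.
Proof.
rewrite /kappa -trlD; apply: trl_eq => v.
by rewrite add_lfunE !comp_lfunE !adE brDl linearD.
Qed.

Lemma kappaZr a x y : kappa x (a *: y) = a * kappa x y.
Proof.
rewrite /kappa -trlZ; apply: trl_eq => v.
by rewrite scale_lfunE !comp_lfunE !adE brZl linearZ.
Qed.

Lemma kappaNr x y : kappa x (- y) = - kappa x y.
Proof. by rewrite -scaleN1r kappaZr mulN1r. Qed.

Lemma kappa0r x : kappa x 0 = 0.
Proof. by rewrite -(scale0r 0) kappaZr mul0r. Qed.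

Lemma kappaDl x y z : kappa (x + y) z = kappa x z + kappa y z.
Proof. by rewrite !(kappa_sym _ z) kappaDr. Qed.

Lemma kappaZl a x y : kappa (a *: x) y = a * kappa x y.
Proof. by rewrite !(kappa_sym _ y) kappaZr. Qed.

Lemma kappa_br x y z : kappa (br x y) z = - kappa y (br x z).
Proof.
have trl3 (f g k : 'End(L)) : trl (f \o (g \o k))%VF = trl (g \o (k \o f))%VF.
  by rewrite trl_comp comp_lfunA.
apply/eqP; rewrite -subr_eq0 opprK; apply/eqP.
(* Inserting the trace of [ad y], [ad x], [ad z] composed in this order splits the sum into two
   commutators; the outer terms cancel by cyclicity of the trace. *)
transitivity (trl (ad x \o (ad y \o ad z))%VF - trl (ad y \o (ad x \o ad z))%VF
  + (trl (ad y \o (ad x \o ad z))%VF - trl (ad y \o (ad z \o ad x))%VF)); last first.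
  by rewrite (trl3 (ad x)) addrA subrK subrr.
have trlB f g : trl f - trl g = trl (f - g) by rewrite trlD -scaleN1r trlZ mulN1r.
rewrite !trlB; congr (_ + _); apply: trl_eq => v;
  rewrite add_lfunE opp_lfunE !comp_lfunE !adE.
- by rewrite (jacobi x y (br z v)) addrK.
- by rewrite (jacobi x z v) linearD /= addrK.
Qed.

(** As [ad x] and [ad z] commute, their product is nilpotent along with [ad x]. This is the test
    showing that a cyclic element is not nilpotent. *)
Lemma kappa_commuting_nilpotent x z n : (forall y, iter n (br x) y = 0) ->
  br x z = 0 -> kappa x z = 0.
Proof.
move=> xn xz; have com y : br x (br z y) = br z (br x y).
  by rewrite jacobi xz br0l add0r.
have comi k y : iter k (br x) (br z y) = br z (iter k (br x) y).
  by elim: k => // k IHk; rewrite !iterS IHk com.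
apply: (@trl_nilpotent _ _ _ n) => v.
have -> : iter n (ad x \o ad z)%VF v = iter n (br x) (iter n (br z) v).
  elim: n {xn} => // n IHn.
  by rewrite iterS IHn comp_lfunE !adE [in RHS]iterS comi.
exact: xn.
Qed.

(** The pairing with a basis as a linear map, so that the radical of [kappa] is a kernel, hence a
    [{vspace L}]. *)
Definition kappa_row x : 'rV[F]_(\dim {:L}) := \row_i kappa x (vbasis {:L})`_i.

Fact kappa_row_is_linear : linear kappa_row.
Proof. by move=> a u v; apply/rowP => i; rewrite !mxE kappaDl kappaZl. Qed.
HB.instance Definition _ :=
  GRing.isLinear.Build F L 'rV[F]_(\dim {:L}) _ kappa_row kappa_row_is_linear.

Lemma kappa_radical_ideal : exists I : {vspace L},
  lie_ideal br I /\ forall x, x \in I <-> forall y, kappa x y = 0.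
Proof.
pose I := lker (linfun kappa_row).
have IP x : x \in I <-> forall y, kappa x y = 0.
  rewrite memv_ker lfunE; split=> [/eqP/rowP x0 y|x0]; last first.
    by apply/eqP/rowP => i; rewrite !mxE.
  rewrite (coord_vbasis (memvf y)).
  apply: (big_ind (fun z => kappa x z = 0)) => [|u v ux vx|i _].
  - exact: kappa0r.
  - by rewrite kappaDr ux vx addr0.
  - by rewrite kappaZr; have := x0 i; rewrite !mxE => ->; rewrite mulr0.
exists I; split => // x y /IP y0; apply/IP => z.
by rewrite kappa_br y0 oppr0.
Qed.

(** * Generalized eigenspaces of [ad N] and derivations *)

Lemma pact_leibniz N a b k l u v :
  pact (ad N) (('X - a%:P) ^+ k) u = 0 -> pact (ad N) (('X - b%:P) ^+ l) v = 0 ->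
  pact (ad N) (('X - (a + b)%:P) ^+ (k + l)) (br u v) = 0.
Proof.
elim: k l u v => [|k IHk] l u v.
  by rewrite expr0 -polyC1 pactC scale1r => ->; rewrite br0l linear0.
elim: l u v => [|l IHl] u v uk vl.
  by move: vl; rewrite expr0 -polyC1 pactC scale1r => ->; rewrite !linear0.
pose u' := ad N u - a *: u; pose v' := ad N v - b *: v.
have uk' : pact (ad N) (('X - a%:P) ^+ k) u' = 0 by rewrite /u' -pactXsubC -pactM -exprSr.
have vl' : pact (ad N) (('X - b%:P) ^+ l) v' = 0 by rewrite /v' -pactXsubC -pactM -exprSr.
(* The Leibniz rule for [ad N - (a + b)]: each of the two terms lowers one of the exponents [k] and
   [l]. *)
have step : ad N (br u v) - (a + b) *: br u v = br u' v + br u v'.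
  rewrite /u' /v' !adE jacobi brDl brNl brZl.
  rewrite scalerDl opprD addrACA; congr (_ + _).
  by rewrite linearB; congr (_ - _); rewrite linearZ.
rewrite addSn exprSr pactM pactXsubC step linearD /= IHk // add0r.
by rewrite addnS -addSn IHl.
Qed.

Section SpectrumDerivation.
Variable N : L.
Let T := ad N.

(** [P] acts as [phi a] on the generalized [a]-eigenspace, and brackets add eigenvalues, so
    additivity of [phi] is the Leibniz rule. The exponent [n + n] is the one that [pact_leibniz]
    gives for a bracket. *)
Lemma additive_spectrum_derivation (R0 R : seq F) n (phi : F -> F) (P : {poly F}) :
  uniq R0 ->
  (forall v, pact T (\prod_(a <- R0) ('X - a%:P) ^+ n) v = 0) ->
  (forall a v, T v = a *: v -> v != 0 -> a \in R) ->
  (forall a b, a \in R -> b \in R -> a + b \in R -> phi (a + b) = phi a + phi b) ->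
  (forall a, a \in R -> ('X - a%:P) ^+ (n + n) %| P - (phi a)%:P) ->
  forall u v, pact T P (br u v) = br (pact T P u) v + br u (pact T P v).
Proof.
move=> uR0 annR0 eigR phiD PR.
have actP a v : a \in R -> pact T (('X - a%:P) ^+ (n + n)) v = 0 ->
    pact T P v = phi a *: v.
  move=> Ra va; apply/eqP; rewrite -subr_eq0 -scaleNr -(pactC T) -pactD polyCN.
  by apply/eqP; apply: pact_dvdp (PR a Ra) va.
have eigP a : (a \in R) || (lker (T - a *: \1)%VF == 0%VS).
  case: (eqVneq (lker (T - a *: \1)%VF) 0%VS) => [_|nz]; first by rewrite orbT.
  rewrite orbF; apply: (eigR a (vpick (lker (T - a *: \1)%VF))); last by rewrite vpick0.
  apply/eqP; rewrite -subr_eq0; have := memv_pick (lker (T - a *: \1)%VF).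
  by rewrite memv_ker add_lfunE opp_lfunE scale_lfunE id_lfunE.
(* Outside [R] generalized eigenspaces vanish; in particular the bracket is zero when [a + b] is not
   in [R], where [phi] is unconstrained. *)
have trivial a k v : a \notin R -> pact T (('X - a%:P) ^+ k) v = 0 -> v = 0.
  move=> aR; apply: pact_root_eq0 => u /eqP ua; have := eigP a; rewrite (negPf aR) /=.
  move=> /eqP ker0; apply/eqP; rewrite -memv0 -ker0.
  by rewrite memv_ker add_lfunE opp_lfunE scale_lfunE id_lfunE subr_eq0.
have wide a v : pact T (('X - a%:P) ^+ n) v = 0 -> pact T (('X - a%:P) ^+ (n + n)) v = 0.
  by apply: pact_dvdp; rewrite exprD dvdp_mulr.
pose D u v := pact T P (br u v) = br (pact T P u) v + br u (pact T P v).
rewrite -/(forall u v, D u v) => u v; move: u.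
apply: (fun P1 P2 P3 u => primary_ind (P := D ^~ v) uR0 P1 P2 P3 (annR0 u)).
- by rewrite /D br0l !linear0 !br0l addr0.
- by move=> u1 u2; rewrite /D linearD !brDl !linearD /= => -> ->; rewrite addrACA.
move=> a u _ ua; move: v.
apply: (fun P1 P2 P3 v => primary_ind (P := D u) uR0 P1 P2 P3 (annR0 v)).
- by rewrite /D !linear0 addr0.
- by move=> v1 v2; rewrite /D !linearD /= => -> ->; rewrite addrACA.
move=> b v _ vb; rewrite /D.
case: (boolP (a \in R)) => [Ra|/trivial/(_ ua) ->]; last first.
  by rewrite !(br0l, linear0) addr0.
case: (boolP (b \in R)) => [Rb|/trivial/(_ vb) ->]; last by rewrite !linear0 addr0.
rewrite (actP a u) ?wide // (actP b v) ?wide // brZl linearZ /= -scalerDl.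
have uv := pact_leibniz ua vb.
case: (boolP (a + b \in R)) => [Rab|/trivial/(_ uv) ->]; last by rewrite linear0 scaler0.
by rewrite -phiD // (actP (a + b)).
Qed.

End SpectrumDerivation.

(** * The grading attached to the triple *)

Section Triple.
Hypothesis F0 : [pchar F] =i pred0.
Variables (e h f : L) (d : nat).
Hypothesis Htriple : sl2_triple br e h f.
Hypothesis e_nil : ad_nilpotent br e.
Hypothesis Hdepth : is_depth br h d.

Lemma br_ef : br e f = h. Proof. by case: Htriple. Qed.
Lemma br_he : br h e = 2%:R *: e. Proof. by case: Htriple. Qed.
Lemma br_hf : br h f = - (2%:R *: f). Proof. by case: Htriple. Qed.

Lemma ad_ef v : ad e (ad f v) = ad f (ad e v) + ad h v.
Proof. by rewrite !adE jacobi br_ef addrC. Qed.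

Lemma ad_he v : ad h (ad e v) = ad e (ad h v) + 2%:R *: ad e v.
Proof. by rewrite !adE jacobi br_he brZl addrC. Qed.

Lemma ad_hf v : ad h (ad f v) = ad f (ad h v) + (- 2%:R) *: ad f v.
Proof. by rewrite !adE jacobi br_hf brNl brZl scaleNr addrC. Qed.

Lemma ad_e_nil : exists n, forall v, iter n (ad e) v = 0.
Proof. by have [n en] := e_nil; exists n => v; rewrite iter_ad. Qed.

Local Notation gr := (wt (ad h)).

Lemma mem_gr j x : x \in gr j <-> in_grade br h j x.
Proof. by rewrite mem_wt adE; split=> [/eqP|/eqP]. Qed.

Lemma gr_gt_d (j : int) x : (d%:Z < j)%R -> x \in gr j -> x = 0.
Proof. by case: Hdepth => _ Hd dj /mem_gr; apply: Hd. Qed.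

Lemma gr_lt_d (j : int) x : (j < - d%:Z)%R -> x \in gr j -> x = 0.
Proof. exact: (wt_lt_d F0 ad_ef ad_he ad_hf gr_gt_d). Qed.

Lemma gr_ind (P : L -> Prop) : P 0 -> (forall u v, P u -> P v -> P (u + v)) ->
  (forall (j : int) v, (- d%:Z <= j <= d%:Z)%R -> v \in gr j -> P v) -> forall v, P v.
Proof. exact: (wt_ind F0 ad_ef ad_he ad_hf ad_e_nil gr_gt_d). Qed.

Lemma gr_br i j x y : x \in gr i -> y \in gr j -> br x y \in gr (i + j).
Proof.
move=> /mem_gr xi /mem_gr yj; apply/mem_gr.
by rewrite /in_grade jacobi xi yj brZl linearZ /= -scalerDl intrD.
Qed.

Lemma gr_e : e \in gr 2. Proof. by apply/mem_gr; apply: br_he. Qed.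

Lemma gr_h : h \in gr 0. Proof. by apply/mem_gr; rewrite /in_grade br_xx scale0r. Qed.

Lemma gr_iter_e k j v : v \in gr j -> iter k (ad e) v \in gr (j + (2 * k)%:Z).
Proof. exact: (wt_iter_e ad_he). Qed.

(** * Odd depth: every cyclic element is nilpotent *)

Section OddDepth.
Local Notation m := (d.+2).

(* For [r < m], the part of degree [r] modulo [m]: no other integer of this class lies
   in [[-d, d]]. *)
Definition cls (r : nat) : {vspace L} := (gr r%:Z + gr (r%:Z - m%:Z))%VS.

Lemma gr_sub_cls (q : int) (r : nat) x :
  x \in gr (r%:Z + q * m%:Z) -> x \in cls (r %% m)%N.
Proof.
set s := (r %% m)%N => xj.
have lt_sm : (s < m)%N by rewrite ltn_mod.
have Dr : r%:Z + q * m%:Z = s%:Z + (q + (r %/ m)%N%:Z) * m%:Z.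
  by rewrite {1}(divn_eq r m) -/s PoszD PoszM; ring.
move: Dr xj => ->; set k := q + _ => xj.
case: (eqVneq k 0) => [k0|nz_k].
  by move: xj; rewrite k0 mul0r addr0; apply: subvP (addvSl _ _) _.
case: (eqVneq k (-1)) => [k1|nz_k1].
  by move: xj; rewrite k1 mulN1r; apply: subvP (addvSr _ _) _.
have [k_gt0|k_lt] : (1 <= k \/ k <= - 2)%R by lia.
  by rewrite (gr_gt_d _ xj) ?mem0v //; nia.
by rewrite (gr_lt_d _ xj) ?mem0v //; nia.
Qed.

(** The polynomial [p] in [ad h] kills both summands of [cls s] and acts on [gr j] by a nonzero
    scalar. *)
Lemma cls_gr_eq0 (s : nat) (j : int) x :
  x \in cls s -> x \in gr j -> j != s%:Z -> j != s%:Z - m%:Z -> x = 0.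
Proof.
move=> /memv_addP [u us [v vs Dx]] xj js jsm.
pose p : {poly F} := ('X - (s%:Z)%:~R%:P) * ('X - (s%:Z - m%:Z)%:~R%:P).
have act i y : y \in gr i ->
    pact (ad h) p y = ((i - s%:Z)%:~R * (i - (s%:Z - m%:Z))%:~R) *: y.
  rewrite mem_wt => /eqP hy.
  by rewrite (pact_eigen _ hy) hornerM !hornerXsubC -!intrB.
have := act _ _ xj; rewrite {1}Dx linearD /= (act _ _ us) (act _ _ vs) !subrr.
rewrite mul0r mulr0 !scale0r addr0 => /esym/eqP.
by rewrite scaler_eq0 mulf_eq0 !intr_eq0_pchar0 // !subr_eq0 (negPf js) (negPf jsm) => /eqP.
Qed.

Variable G : L.
Hypothesis G_wt : G \in gr (- d%:Z).
Let T := ad (e + G).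

(** Since [- d = 2 - m], both [e] and [G] have degree 2 modulo [m]. *)
Lemma cyclic_cls r x : (r < m)%N -> x \in cls r -> T x \in cls ((r + 2) %% m)%N.
Proof.
move=> rm /memv_addP [u ur [v vr ->]].
rewrite adE brDl !linearD /=; rewrite !rpredD //.
- by have := gr_br gr_e ur; rewrite (_ : _ + _ = (r + 2)%N%:Z + 0 * m%:Z);
    [apply: gr_sub_cls | lia].
- by have := gr_br gr_e vr; rewrite (_ : _ + _ = (r + 2)%N%:Z + (-1) * m%:Z);
    [apply: gr_sub_cls | lia].
- by have := gr_br G_wt ur; rewrite (_ : _ + _ = (r + 2)%N%:Z + (-1) * m%:Z);
    [apply: gr_sub_cls | lia].
- by have := gr_br G_wt vr; rewrite (_ : _ + _ = (r + 2)%N%:Z + (-2) * m%:Z);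
    [apply: gr_sub_cls | lia].
Qed.

Lemma pact_cls (P : {poly F}) r x :
  (forall i, P`_i != 0 -> (2 * i = 1 %[mod m])%N) ->
  (r < m)%N -> x \in cls r -> pact T P x \in cls ((r + 1) %% m)%N.
Proof.
move=> P1 rm xr; have Tr i : iter i T x \in cls ((r + 2 * i) %% m)%N.
  elim: i => [|i IHi]; first by rewrite muln0 addn0 modn_small.
  rewrite iterS (_ : r + 2 * i.+1 = r + 2 * i + 2)%N; last by lia.
  by rewrite -modnDml cyclic_cls // ltn_mod.
apply: rpred_sum => i _; case: (eqVneq P`_i 0) => [->|nzPi].
  by rewrite scale0r mem0v.
by rewrite rpredZ //; have := Tr i; rewrite -modnDmr P1 // modnDmr.
Qed.

Lemma iter_gr1_nilpotent y : y \in gr 1 ->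
  exists n, forall x, iter n (br y) x = 0.
Proof.
(* Each application of [br y] raises the weight by 1, and [2 d + 1] of them lead from any weight in
   [[-d, d]] beyond [d]. *)
move=> y1; exists (2 * d).+1; set n := (2 * d).+1.
have lin0 : iter n (br y) 0 = 0 by elim: n => // k IHk; rewrite iterS IHk linear0.
apply: gr_ind => // [u v u0 v0|j x dj xj].
  have iterD k : iter k (br y) (u + v) = iter k (br y) u + iter k (br y) v.
    by elim: k => // k IHk; rewrite !iterS IHk linearD.
  by rewrite iterD u0 v0 addr0.
have xk k : iter k (br y) x \in gr (j + k%:Z).
  elim: k => [|k IHk]; first by rewrite addr0.
  by have := gr_br y1 IHk; rewrite (_ : 1 + _ = j + k.+1%:Z) //; lia.
by apply: gr_gt_d (xk n); lia.
Qed.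

Hypothesis odd_d : odd d.

(* [D] and [- ad (D h)] differ by an operator that commutes with [ad h] and has degree 1
   modulo [m], hence vanishes. *)
Lemma degree1_derivation_inner (D : {linear L -> L}) :
  (forall u v, D (br u v) = br (D u) v + br u (D v)) ->
  (forall r x, (r < m)%N -> x \in cls r -> D x \in cls ((r + 1) %% m)%N) ->
  exists2 y, y \in gr 1 & forall x, D x = - br y x.
Proof.
move=> Dder Dcls.
have y1 : D h \in gr 1.
  have hcls : h \in cls 0.
    by apply: (@gr_sub_cls 0 0); rewrite mul0r; apply: gr_h.
  have := Dcls 0%N h isT hcls; rewrite modn_small // => /memv_addP [u u1 [v v1 ->]].
  (* The second summand of [cls 1] has weight [1 - m = - d - 1], hence is zero. *)
  by rewrite (gr_lt_d _ v1) ?addr0 //; lia.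
exists (D h) => //; apply: gr_ind => [|u v u0 v0|j x dj xj].
- by rewrite !linear0.
- by rewrite !linearD /= u0 v0.
pose r := absz (j + m%:Z)%R.
have Dj : j = r%:Z + (-1) * m%:Z by rewrite /r; lia.
set eps := D x + br (D h) x.
suff: eps = 0 by move/eqP; rewrite addr_eq0 => /eqP.
(* This combines [D] applied to [br h x] with [br h (D h) = D h]. *)
have eps_j : eps \in gr j.
  move: (xj); rewrite !mem_wt !adE => /eqP hx.
  have /eqP := Dder h x; rewrite hx linearZ /= addrC -subr_eq => /eqP Dhx.
  move: (y1); rewrite mem_wt adE => /eqP hy.
  rewrite /eps linearD /= -Dhx jacobi hy hx brZl linearZ /= scale1r.
  by rewrite addrA subrK scalerDr.
have eps_cls : eps \in cls ((r + 1) %% m).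
  rewrite rpredD //.
    rewrite -modnDml; apply: Dcls; first by rewrite ltn_mod.
    by apply: (@gr_sub_cls (-1)); rewrite -Dj.
  apply: (@gr_sub_cls (-1)).
  by have := gr_br y1 xj; rewrite (_ : 1 + j = (r + 1)%N%:Z + (-1) * m%:Z) //; lia.
have neq a b : (a * m = b * m + 1)%N -> False.
  by move/(congr1 (modn^~ m)); rewrite modnMl modnMDl modn_small.
have Dr := divn_eq (r + 1) m; apply: cls_gr_eq0 eps_cls eps_j _ _.
  apply/eqP => js; apply: (neq ((r + 1) %/ m)%N 1%N).
  by move: Dr js; rewrite {}Dj; move: (_ %/ _)%N (_ %% _)%N => k s; lia.
apply/eqP => js; apply: (neq ((r + 1) %/ m)%N 0%N).
by move: Dr js; rewrite {}Dj; move: (_ %/ _)%N (_ %% _)%N => k s; lia.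
Qed.

Lemma eigenvalue_mem_roots (R : seq F) n a v : uniq R ->
  (forall u, pact T (\prod_(b <- R) ('X - b%:P) ^+ n) u = 0) ->
  T v = a *: v -> v != 0 -> a \in R.
Proof.
move=> uR annR Tv nzv; have /eqP := annR v.
rewrite (pact_eigen _ Tv) scaler_eq0 (negPf nzv) orbF horner_prod prodf_seq_eq0.
case/hasP => b bR /=; rewrite horner_exp hornerXsubC expf_eq0 subr_eq0.
by case/andP => _ /eqP ->.
Qed.

Lemma odd_depth_cyclic_nilpotent : ad_nilpotent br (e + G).
Proof.
have [R1 [n uR1 annR1]] := annihilating_split_poly T.
pose eig a := lker (T - a *: \1)%VF != 0%VS.
have eigP a : eig a <-> exists2 v, T v = a *: v & v != 0.
  have kerE v : (v \in lker (T - a *: \1)%VF) = (T v == a *: v).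
    by rewrite memv_ker add_lfunE opp_lfunE scale_lfunE id_lfunE subr_eq0.
  split=> [nz|[v Tv nzv]].
    exists (vpick (lker (T - a *: \1)%VF)); last by rewrite vpick0.
    by apply/eqP; rewrite -kerE memv_pick.
  apply: contra nzv => /eqP ker0; rewrite -memv0 -ker0 kerE; exact/eqP.
case: (boolP (has (fun a => eig a && (a != 0)) R1)) => [/hasP [a0 Ra0 /andP [eiga0 nza0]]|].
  exfalso.
  have [w prim_w] := closed_prim_root_exists F0 (isT : (0 < m)%N).
  pose z := w ^+ 2.
  have prim_z : m.-primitive_root z.
    by rewrite (prim_root_exp_coprime _ prim_w) coprime2n /= negbK.
  pose R := undup [seq z ^+ k * a | k <- iota 0 m, a <- [seq a <- R1 | eig a]].
  have RP b : reflect (exists k, exists2 a, eig a & b = z ^+ k * a) (b \in R).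
    rewrite mem_undup; apply: (iffP allpairsP) => [[[k a] [_ /= aR ->]]|[k [a eiga ->]]].
      by exists k, a => //; move: aR; rewrite mem_filter => /andP [].
    exists ((k %% m)%N, a); split.
    - by rewrite mem_iota; apply: ltn_pmod.
    - rewrite -[_.2]/a mem_filter eiga; have [v Tv nzv] := (eigP a).1 eiga.
      exact: eigenvalue_mem_roots uR1 annR1 Tv nzv.
    - by rewrite /= (prim_expr_mod prim_z).
  have uR : uniq R by apply: undup_uniq.
  have eigR a : eig a -> a \in R.
    by move=> eiga; apply/RP; exists 0%N, a => //; rewrite mul1r.
  have Rz : {homo *%R z : a / a \in R}.
    move=> _ /RP [k [a eiga ->]]; apply/RP; exists k.+1, a => //.
    by rewrite exprS mulrA.
  have [phi [[b Rb nzb] phi_z phiD]] : exists phi : F -> F,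
    [/\ exists2 a, a \in R & phi a != 0,
      {in R, forall a, phi (z * a) = w * phi a} &
      forall a b, a \in R -> b \in R -> a + b \in R -> phi (a + b) = phi a + phi b].
    apply: (additive_twist F0 uR prim_z prim_w) => //; exists a0 => //.
    exact: eigR.
  (* The exponent [n + n] serves the derivation property; the extra unit keeps it positive, so that
     [P] acts as [phi a] on eigenvectors. *)
  have [P [Psupp Pcong]] := twisted_interpolation F0 uR (isT : (0 < m)%N)
    (prim_expr_order prim_w) (prim_expr_order prim_z) Rz phi_z (n + n).+1.
  have der : forall u v, pact T P (br u v) = br (pact T P u) v + br u (pact T P v).
    apply: (additive_spectrum_derivation uR1 annR1 _ phiD).
      by move=> a v Tv nzv; apply: eigR; apply/eigP; exists v.
    by move=> a Ra; apply: dvdp_trans (Pcong a Ra); rewrite dvdp_exp2l.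
  have Pdeg r x : (r < m)%N -> x \in cls r -> pact T P x \in cls ((r + 1) %% m)%N.
    (* As [z = w ^+ 2], the condition [z ^+ i = w] means that [2 i] is 1 modulo [m]. *)
    apply: pact_cls => i /Psupp zi; apply/eqP.
    by rewrite -(eq_prim_root_expr prim_w) exprM expr1 -/z zi.
  have [y y1 Dy] := degree1_derivation_inner der Pdeg.
  have [l nil_y] := iter_gr1_nilpotent y1.
  have [k [a eiga Db]] := RP b Rb.
  have Ra := eigR a eiga; have [v Tv nzv] := (eigP a).1 eiga.
  (* The element [b] of [R] may fail to be an eigenvalue, but [b = z ^+ k * a] for an eigenvalue
     [a], and [phi b = w ^+ k * phi a]. *)
  have nza : phi a != 0.
    apply: contra nzb => /eqP phia.
    by rewrite Db (phi_expr Rz phi_z k Ra).2 phia mulr0.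
  have Pv : pact T P v = phi a *: v.
    apply/eqP; rewrite -subr_eq0 -scaleNr -(pactC T) -pactD polyCN.
    apply/eqP; apply: pact_dvdp (Pcong a Ra) _.
    by rewrite exprSr pactM pactXsubC Tv subrr linear0.
  have yv : br y v = - phi a *: v by rewrite scaleNr -Pv Dy opprK.
  have itv i : iter i (br y) v = (- phi a) ^+ i *: v.
    elim: i => [|i IHi]; first by rewrite scale1r.
    by rewrite iterS IHi linearZ /= yv scalerA exprSr.
  have /eqP := nil_y v; rewrite itv scaler_eq0 (negPf nzv) orbF expf_eq0 oppr_eq0.
  by rewrite (negPf nza) andbF.
(* No nonzero element of [R1] is an eigenvalue, so only the primary component at 0 survives, and
   [T ^ n] kills it. *)
move/hasPn => eig0; exists n => x; rewrite -iter_ad -/T.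
apply: (primary_ind (P := fun u => iter n T u = 0) uR1 _ _ _ (annR1 x)).
- exact: linear0.
- by move=> u v u0 v0; rewrite linearD /= u0 v0 addr0.
move=> a v Ra va; have := eig0 a Ra; rewrite negb_and negbK => /orP [neig|/eqP a0].
  suff -> : v = 0 by apply: linear0.
  apply: pact_root_eq0 va => u Tu; apply/eqP; apply: contraNT neig => nzu.
  by apply/eigP; exists u.
move: va; rewrite a0 subr0 => <-.
by elim: (n) => [|k IHk]; rewrite ?expr0 -?polyC1 ?pactC ?scale1r // exprSr pactMX iterS IHk.
Qed.

End OddDepth.

(** * The Killing form and even depth *)

Lemma kappa_gr i j x y : x \in gr i -> y \in gr j -> i + j != 0 -> kappa x y = 0.
Proof.
move=> /mem_gr xi /mem_gr yj nz; apply/eqP.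
have /eqP := kappa_br h x y; rewrite xi yj kappaZl kappaZr.
rewrite -addr_eq0 -mulrDl mulf_eq0 => /orP [|//].
by rewrite -intrD intr_eq0_pchar0 // (negPf nz).
Qed.

Lemma ad_h2_eigenvalue a v : ad h (ad h v) = a *: v -> v != 0 ->
  exists k : nat, a = k%:R.
Proof.
move=> hv nzv; pose H2 := (ad h \o ad h)%VF.
pose q : {poly F} := \prod_(i < (d + d).+1) ('X - (absz (i%:Z - d%:Z)%R ^ 2)%:R%:P).
have q0 x : pact H2 q x = 0.
  move: x; apply: gr_ind => [|u w u0 w0|j x dj xj]; first exact: linear0.
    by rewrite linearD /= u0 w0 addr0.
  have hx : H2 x = (absz j ^ 2)%:R *: x.
    rewrite comp_lfunE !adE; move/mem_gr: xj => hx.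
    rewrite hx linearZ /= hx scalerA -intrM; congr (_ *: _).
    by rewrite pmulrn; congr (_ *~ _); lia.
  have lt_i : (absz (j + d%:Z)%R < (d + d).+1)%N by lia.
  rewrite (pact_eigen _ hx) horner_prod (bigD1 (Ordinal lt_i)) //= hornerXsubC.
  have -> : (absz (j + d%:Z)%R)%:Z - d%:Z = j by lia.
  by rewrite subrr mul0r scale0r.
have H2v : H2 v = a *: v by rewrite comp_lfunE.
have /eqP := q0 v; rewrite (pact_eigen _ H2v) scaler_eq0 (negPf nzv) orbF horner_prod.
case/prodf_eq0 => i _; rewrite hornerXsubC subr_eq0 => /eqP ->.
by exists (absz (i%:Z - d%:Z)%R ^ 2)%N.
Qed.

Hypothesis nze : e != 0.

(** The trace is a sum of eigenvalues of the square of [ad h], all natural numbers; [e] contributes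
    the eigenvalue 4, so the sum is positive. *)
Lemma kappa_hh_neq0 : kappa h h != 0.
Proof.
have [rs rsP] := trl_eigenvalues (ad h \o ad h)%VF.
rewrite /kappa => ->.
have four : 4%:R \in rs.
  apply/rsP; exists e => //; rewrite comp_lfunE !adE br_he linearZ /= br_he scalerA.
  by rewrite -natrM.
have rsN a : a \in rs -> exists k : nat, a = k%:R.
  by case/rsP => v; rewrite comp_lfunE; apply: ad_h2_eigenvalue.
suff [k [-> k4]] : exists k : nat, \sum_(a <- rs) a = k%:R /\ (4%:R \in rs -> 0 < k)%N.
  by rewrite natr_eq0_pchar0 // -lt0n k4.
elim: rs {rsP four} rsN => [_|a s IHs sN]; first by exists 0%N; rewrite big_nil.
have [|k [Dk k4]] := IHs; first by move=> b bs; apply: sN; rewrite inE bs orbT.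
have [l Dl] := sN a (mem_head _ _).
exists (l + k)%N; rewrite big_cons Dk Dl -natrD; split=> //.
rewrite inE addn_gt0 => /orP [/eqP |/k4 ->]; last by rewrite orbT.
rewrite lt0n -(natr_eq0_pchar0 F0) => <-.
by rewrite natr_eq0_pchar0.
Qed.

Hypothesis Hsimple : simple_lie br.

(** The radical is an ideal that does not contain [h], hence zero by simplicity. *)
Lemma kappa_nondegenerate x : (forall y, kappa x y = 0) -> x = 0.
Proof.
have [I [Iid IP]] := kappa_radical_ideal; case: Hsimple => _ /(_ I Iid) [I0|IL] /IP.
  by rewrite I0 memv0 => /eqP.
have /IP/(_ h)/eqP : h \in I by rewrite IL memvf.
by rewrite (negPf kappa_hh_neq0).
Qed.

Section LowestVector.
Variable G : L.
Hypothesis G_wt : G \in gr (- d%:Z).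

Local Notation E i := (iter i (ad e) G).
Let c i := br (E i) (E (d - i)).
Let b i := br (E i) (E (d - i.+1)).
(** The weights of [c i] and [b i] are 0 and -2, and [br e (b i) = c i + c i.+1]. The coefficients
    are chosen so that [br e Z] is [d.+1%:R *: c 0] minus the alternating sum of all the [c i]. *)
Let Z := \sum_(i < d) ((-1) ^+ i * (d%:R - i%:R)) *: b i.

Let E_wt i : E i \in gr ((2 * i)%:Z - d%:Z).
Proof. by have := gr_iter_e i G_wt; rewrite addrC. Qed.

Let br_e_b i : (i < d)%N -> br e (b i) = c i + c i.+1.
Proof.
move=> lt_id; rewrite jacobi addrC; congr (br _ _ + br _ _); last by rewrite iterS adE.
by rewrite -(adE e) -iterS subnSK.
Qed.

Let br_e_partial n : (n <= d)%N ->
  \sum_(i < n) ((-1) ^+ i * (d%:R - i%:R)) *: (c i + c i.+1) =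
  d.+1%:R *: c 0%N - \sum_(i < n.+1) (-1) ^+ i *: c i
  - ((-1) ^+ n * (d%:R - n%:R)) *: c n.
Proof.
elim: n => [_|n IHn lt_nd].
  rewrite big_ord0 big_ord1 -natr1 scalerDl !expr0 !scale1r addrK mul1r subr0.
  by rewrite subrr.
rewrite big_ord_recr /= (IHn (ltnW lt_nd)) [in RHS]big_ord_recr /=.
rewrite scalerDr !addrA subrK opprD !addrA -[RHS]addrA; congr (_ + _).
by rewrite -!scaleNr -scalerDl; congr (_ *: _); rewrite -natr1 exprS; ring.
Qed.

(** Reversing the order of summation changes [c i] into [c (d - i) = - c i] and, for [d] even,
    preserves the signs. *)
Let alternating_sum0 : ~~ odd d -> \sum_(i < d.+1) (-1) ^+ i *: c i = 0.
Proof.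
move=> even_d; set S := \sum_(i < _) _.
have : S = - S.
  rewrite {1}/S (reindex_inj rev_ord_inj) /= -sumrN; apply: eq_bigr => i _.
  have le_id : (i <= d)%N by rewrite -ltnS ltn_ord.
  rewrite subSS /c subKn // -signr_odd oddB // (negPf even_d) /= signr_odd.
  by rewrite br_anti scalerN.
move/eqP; rewrite -addr_eq0 -mulr2n -scaler_nat scaler_eq0 natr_eq0_pchar0 //=.
by move/eqP.
Qed.

Let br_e_Z : ~~ odd d -> br e Z = d.+1%:R *: br G (E d).
Proof.
move=> even_d; rewrite /Z linear_sum /=.
transitivity (\sum_(i < d) ((-1) ^+ i * (d%:R - i%:R)) *: (c i + c i.+1)).
  by apply: eq_bigr => i _; rewrite linearZ /= br_e_b.
rewrite br_e_partial // alternating_sum0 // subr0 subrr mulr0 scale0r subr0.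
by rewrite /c subn0.
Qed.

Let Z_wt : Z \in gr (- 2).
Proof.
apply: rpred_sum => i _; rewrite rpredZ //.
have := gr_br (E_wt i) (E_wt (d - i.+1)).
by rewrite (_ : _ + _ = - 2) //; have := ltn_ord i; lia.
Qed.

(** The vector [z] commutes with [e + G]: the brackets of weights [d + 2] and [- d - 2] vanish, and
    those of weight 0 cancel by [br_e_Z]. Nilpotency then forces [kappa (e + G) z = 0]. *)
Lemma kappa_lowest_eq0 : ~~ odd d -> ad_nilpotent br (e + G) ->
  kappa (E d) G = 0.
Proof.
move=> even_d [n Nnil].
have d1 : d.+1%:R != 0 :> F by rewrite natr_eq0_pchar0.
pose z := E d - d.+1%:R^-1 *: Z.
have Gwt2 : br h G = - d%:R *: G by move/mem_gr: G_wt; rewrite /in_grade mulrNz.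
have brz u : br u z = br u (E d) - d.+1%:R^-1 *: br u Z.
  by rewrite /z linearB; congr (_ - _); rewrite linearZ.
have com : br (e + G) z = 0.
  rewrite brDl !brz br_e_Z // scalerA mulVf // scale1r.
  have -> : br e (E d) = 0.
    by apply: (@gr_gt_d (d%:Z + 2)); [lia | have := E_wt d.+1;
      rewrite iterS adE (_ : _ - _ = d%:Z + 2) //; lia].
  have -> : br G Z = 0.
    by apply: (@gr_lt_d (- d%:Z + - 2)); [lia | apply: gr_br G_wt Z_wt].
  by rewrite scaler0 subr0 sub0r addNr.
have := kappa_commuting_nilpotent Nnil com.
(* Writing [2 e] as [br h e] and using invariance twice expresses [kappa e Z] through
   [kappa G (E d)]. *)
have keZ : 2%:R * kappa e Z = - (d.+1%:R * d%:R * kappa G (E d)).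
  have : kappa (br e h) Z = - kappa h (br e Z) by rewrite kappa_br.
  rewrite (br_anti e h) br_he -scalerN -scaleN1r scalerA kappaZl mulrN1 mulNr.
  move/oppr_inj => ->; rewrite br_e_Z // kappaZr -mulrA -mulrN; congr (_ * _).
  have : kappa (br G h) (E d) = - kappa h (br G (E d)) by rewrite kappa_br.
  by rewrite (br_anti G h) Gwt2 scaleNr opprK kappaZl => ->; rewrite opprK.
rewrite /z kappaDl !kappaDr !kappaNr !kappaZr.
rewrite (kappa_gr gr_e (E_wt d)); last by lia.
rewrite (kappa_gr G_wt Z_wt); last by lia.
rewrite mulr0 oppr0 addr0 add0r => k0.
(* By [keZ], [kappa (e + G) z] equals [(1 + d / 2)] times [kappa G (E d)]. *)
have : d.+2%:R * kappa G (E d) = 0.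
  have -> : d.+2%:R * kappa G (E d) =
      2%:R * (- (d.+1%:R^-1 * kappa e Z) + kappa G (E d)).
    rewrite mulrDr mulrN mulrCA keZ mulrN opprK -mulrA mulKf // -mulrDl.
    by rewrite -addn2 natrD.
  by rewrite k0 mulr0.
move/eqP; rewrite mulf_eq0 natr_eq0_pchar0 //= => /eqP <-.
exact: kappa_sym.
Qed.

End LowestVector.

Lemma kappa_iter_e k x y : kappa (iter k (ad e) x) y = (-1) ^+ k * kappa x (iter k (ad e) y).
Proof.
elim: k x => [|k IHk] x; first by rewrite mul1r.
by rewrite iterSr IHk adE kappa_br iterS adE exprS mulN1r mulrN mulNr.
Qed.

Lemma even_depth_not_nilpotent_type : ~~ odd d -> ~ nilpotent_type br e h d.
Proof.
move=> even_d nilp; have [[x [nzx /mem_gr xd]] _] := Hdepth.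
have B0 G : G \in gr (- d%:Z) -> kappa (iter d (ad e) G) G = 0.
  move=> Gd; case: (eqVneq G 0) => [->|nzG]; first exact: kappa0r.
  by apply: kappa_lowest_eq0 => //; apply: nilp => //; apply/mem_gr.
pose F1 := iter d (ad f) x.
have F1d : F1 \in gr (- d%:Z).
  have := wt_iter_f ad_hf d xd; rewrite (_ : _ - _ = - d%:Z) //; lia.
have ex : ad e x = 0.
  by apply: (@gr_gt_d (d%:Z + 2)); [lia | apply: (wt_e ad_he xd)].
have [c nzc Dc] := iter_ef_highest F0 ad_ef ad_hf xd ex (leqnn d).
(* Polarization of [B0]: for [d] even the form is symmetric, and [x] is a nonzero multiple of the
   image of [F1] under the [d]-th power of [ad e]. *)
have B1 y : y \in gr (- d%:Z) -> kappa x y = 0.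
  move=> yd; have := B0 _ (rpredD F1d yd).
  rewrite linearD kappaDl !kappaDr /= !B0 // addr0 add0r.
  rewrite [kappa (iter d _ y) _]kappa_iter_e -signr_odd (negPf even_d) mul1r.
  rewrite [kappa y _]kappa_sym -mulr2n -mulr_natr Dc kappaZl => /eqP.
  by rewrite !mulf_eq0 natr_eq0_pchar0 // orbF (negPf nzc) => /eqP.
(* Only weight [- d] can pair with [x], and [B1] excludes it, so [x] lies in the radical of
   [kappa]. *)
case/eqP: nzx; apply: kappa_nondegenerate => y; move: y.
apply: gr_ind => [|u v u0 v0|j y _ yj]; first exact: kappa0r.
  by rewrite kappaDr u0 v0 addr0.
case: (eqVneq (d%:Z + j) 0) => [dj|]; last exact: kappa_gr.
by apply: B1; rewrite (_ : - d%:Z = j) //; lia.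
Qed.

End Triple.

End LieBasics.

Theorem theorem1p1 (F : closedFieldType) (HF : [pchar F] =i pred0)
  (L : vectType F) (br : L -> L -> L)
  (Hlie : lie_bracket br) (Hsimple : simple_lie br)
  (e h f : L) (He0 : e != 0) (Hnil : ad_nilpotent br e)
  (Htriple : sl2_triple br e h f)
  (d : nat) (Hdepth : is_depth br h d) :
  nilpotent_type br e h d <-> odd d.
Proof.
split=> [nilp | odd_d G _ G_wt].
  apply/negPn/negP => even_d.
  apply: (even_depth_not_nilpotent_type Hlie HF Htriple Hnil Hdepth He0 Hsimple even_d nilp).
apply: (odd_depth_cyclic_nilpotent Hlie HF Htriple Hnil Hdepth _ odd_d).
exact/mem_gr.
Qed.
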